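(* Let $L$ be an oriented link and let $k\ge 1$ be an integer. (a) If $t^k=(-1)^k$, with $t^{1/2}=-ie^{\pi i m/k}$ for an integer $m$, and $t\neq -1$, then a $t_k$ move changes $V_L(t)$ by the factor $(-1)^mi^k$, that is, $$V_{t_k(L)}(t)=(-1)^m i^k V_L(t).$$ (b) If $t^{2k}=1$ (i.e. $t=e^{\pi i m/k}$ for an integer $m$) and $t\neq -1$, then $$V_{\bar t_{2k}(L)}(t)=V_L(t).$$ (c) Assume $k$ is odd, $t^k=-1$ and $t\ne -1$. Then for any choice of orientation of $\bar t_k(L)$ that is an orientation as specified in the context, $$V_{\bar t_k(L)}(t)=\omega_{4k}V_L(t)$$ for a suitable $4k$-th root of unity $\omega_{4k}$ (depending also on the choice of the orientation of $\bar t_k(L)$).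
   Context: The Jones polynomial $V_L(t)\in\mathbb{Z}[t^{\pm1/2}]$ is the invariant of oriented links in $S^3$ determined by (i) $V_{T_1}(t)=1$ for the trivial knot $T_1$, and (ii) $t^{-1}V_{L_+}(t)-tV_{L_-}(t)=(\sqrt t-\frac1{\sqrt t})V_{L_0}(t)$, where $L_+,L_-,L_0$ are oriented diagrams identical except near one point, where they have respectively a positive crossing, a negative crossing, and the oriented smoothing. Evaluation at a complex number $t$ means a choice of $t^{1/2}$ is fixed. A $t_k$ move: $L$ is an oriented diagram which in some disk consists of two crossingless parallel strands oriented in the same direction; $t_k(L)$ is obtained by replacing them by the two-strand braid with $k$ half twists, all $k$ crossings being positive. A $\bar t_k$ move: $L$ is an oriented diagram which in some disk consists of two crossingless parallel strands oriented in opposite directions; $\bar t_k(L)$ is obtained by inserting $k$ half twists of the two strands around each other, of the handedness for which the crossings would be positive if the strands were oriented in the same direction. If $k$ is even, $\bar t_k(L)$ inherits the orientation of $L$. If $k$ is odd, $\bar t_k(L)$ is oriented as follows. If two different components $L_i,L_j$ of $L$ are involved in the move, choose one of them, say $L_i$; $\bar t_k(L)$ is oriented so that its orientation agrees with that of $L$ outside the disk except on $L_i$, where it is opposite. If a single component of $L$ is involved, let $L_\infty$ be the oriented link obtained by replacing the two antiparallel strands in the disk by the other crossingless pair of arcs (joining the two upper endpoints to each other and the two lower endpoints to each other); this splits the component into two new components $L_i,L_j$ of $L_\infty$; choose one, say $L_i$; $\bar t_k(L)$ is oriented so that its orientation agrees with that of $L_\infty$ outside the disk except on $L_i$, where it is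 opposite. *)

(* Defs.v *)
From mathcomp Require Export all_boot all_order all_algebra fraction.
From mathcomp Require Export complex.
From mathcomp Require Export reals trigo.

Set Implicit Arguments.
Unset Strict Implicit.
Unset Printing Implicit Defensive.

Import GRing.Theory.

(* Oriented link diagrams are written as Morse words: the diagram, in general
   position with respect to the height function, is cut by horizontal lines
   into elementary pieces, which are listed from bottom to top.  A horizontal
   line meets the diagram in finitely many points, numbered from the left
   starting at 0; its state lists the directions of the strands at these
   points, [true] meaning upwards.
   - [Cup i b] is a local minimum whose two legs become the strands i and i+1
     of the line above it; [b] is the direction of its left leg.
   - [Cap i] is a local maximum joining the strands i and i+1.
   - [Cross c i] is a crossing of the strands i and i+1; the strand running from
     lower left to upper right is the overstrand iff [c].  Hence [Cross true i]
     is positive iff the two strands are both upward or both downward. *)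
Inductive piece :=
  | Cup of nat & bool
  | Cap of nat
  | Cross of bool & nat.

Definition diagram := seq piece.

Definition step (s : seq bool) (p : piece) : option (seq bool) :=
  match p with
  | Cup i b =>
      if i <= size s then Some (take i s ++ [:: b; ~~ b] ++ drop i s) else None
  | Cap i =>
      if drop i s is x :: y :: s' then
        if x != y then Some (take i s ++ s') else None
      else None
  | Cross _ i =>
      if drop i s is x :: y :: s' then Some (take i s ++ [:: y; x] ++ s')
      else None
  end.

(* [None] when some piece does not fit the line below it *)
Definition run (D : diagram) : option (seq bool) :=
  foldl (fun o p => obind (fun s => step s p) o) (Some [::]) D.

(* [D] is the diagram of an oriented link, not only of a tangle or nonsense. *)
Definition closed (D : diagram) : bool := run D == Some [::].

Definition top (D : diagram) : seq bool := odflt [::] (run D).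

Definition pos (p : piece) : nat :=
  match p with Cup i _ => i | Cap i => i | Cross _ i => i end.

Definition set_pos (p : piece) (j : nat) : piece :=
  match p with
  | Cup _ b => Cup j b
  | Cap _ => Cap j
  | Cross c _ => Cross c j
  end.

Definition nin (p : piece) : nat := if p is Cup _ _ then 0 else 2.
Definition nout (p : piece) : nat := if p is Cap _ then 0 else 2.

(* Turaev's moves, which generate isotopy of links in S^3 on Morse words:
   planar isotopy ([far], [zigzag], [slide]) and Reidemeister moves. *)
Inductive move : diagram -> diagram -> Prop :=
  | far p q : pos p + nin p <= pos q ->
      move [:: q; p] [:: p; set_pos q (pos q - nin p + nout p)]
  | zigzag_left i b : move [:: Cup i.+1 b; Cap i] [::]
  | zigzag_right i b : move [:: Cup i b; Cap i.+1] [::]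
  | slide_cup c i b :
      move [:: Cup i b; Cross c i.+1] [:: Cup i.+1 b; Cross (~~ c) i]
  | slide_cap c i :
      move [:: Cross c i.+1; Cap i] [:: Cross (~~ c) i; Cap i.+1]
  | reidemeister1_cup c i b : move [:: Cup i b; Cross c i] [:: Cup i (~~ b)]
  | reidemeister1_cap c i : move [:: Cross c i; Cap i] [:: Cap i]
  | reidemeister2 c i : move [:: Cross c i; Cross (~~ c) i] [::]
  (* the side condition excludes the triangles without a top strand *)
  | reidemeister3 a b c i : (b == a) || (b == c) ->
      move [:: Cross a i; Cross b i.+1; Cross c i]
           [:: Cross c i.+1; Cross b i; Cross a i.+1].

Inductive isotopic : diagram -> diagram -> Prop :=
  | iso_move u a b v : move a b -> closed (u ++ a ++ v) ->
      closed (u ++ b ++ v) -> isotopic (u ++ a ++ v) (u ++ b ++ v)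
  | iso_refl D : isotopic D D
  | iso_sym D D' : isotopic D D' -> isotopic D' D
  | iso_trans D D' D'' : isotopic D D' -> isotopic D' D'' -> isotopic D D''.

Definition parallel (s : seq bool) (i : nat) : bool :=
  (i.+1 < size s) && (nth false s i == nth false s i.+1).

Definition antiparallel (s : seq bool) (i : nat) : bool :=
  (i.+1 < size s) && (nth false s i != nth false s i.+1).

(* [skein_triple Lplus Lminus L0].  The oriented smoothing of a crossing of
   antiparallel strands is a cap below a cup; the left leg of that cup continues
   the strand i+1 below the crossing. *)
Inductive skein_triple : diagram -> diagram -> diagram -> Prop :=
  | skein_parallel u v i :
      parallel (top u) i -> closed (u ++ [:: Cross true i] ++ v) ->
      skein_triple (u ++ [:: Cross true i] ++ v)
                   (u ++ [:: Cross false i] ++ v)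
                   (u ++ v)
  | skein_antiparallel u v i :
      antiparallel (top u) i -> closed (u ++ [:: Cross true i] ++ v) ->
      skein_triple (u ++ [:: Cross false i] ++ v)
                   (u ++ [:: Cross true i] ++ v)
                   (u ++ [:: Cap i; Cup i (nth false (top u) i.+1)] ++ v).

(* The pair (p, n) stands for the Laurent polynomial q^-n p(q), q = t^(1/2).
   This is not unique, so Laurent polynomials are compared by [lfrac]. *)
Definition laurent : Type := ({poly int} * nat)%type.

Local Open Scope ring_scope.

Definition sqrt_t : {fraction {poly int}} := tofrac ('X : {poly int}).

Definition lfrac (f : laurent) : {fraction {poly int}} :=
  tofrac f.1 / sqrt_t ^+ f.2.

(* the value at t^(1/2) = s *)
Definition leval (R : realType) (s : R[i]) (f : laurent) : R[i] :=
  (map_poly intr f.1).[s] / s ^+ f.2.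

Definition is_jones (V : diagram -> laurent) : Prop :=
  [/\ forall D D', closed D -> isotopic D D' -> lfrac (V D) = lfrac (V D'),
      forall b, lfrac (V [:: Cup 0 b; Cap 0]) = 1
    & forall Lp Lm L0, skein_triple Lp Lm L0 ->
        (sqrt_t ^+ 2)^-1 * lfrac (V Lp) - sqrt_t ^+ 2 * lfrac (V Lm)
        = (sqrt_t - sqrt_t^-1) * lfrac (V L0)].

(* e^(i x) *)
Definition cis (R : realType) (x : R) : R[i] := (cos x +i* sin x)%C.

Local Open Scope nat_scope.

(* k half twists of the strands i and i+1: the crossings are positive when these
   strands are parallel, negative when they are antiparallel and k is even. *)
Definition twist (k i : nat) : diagram := nseq k (Cross true i).

(* L' is obtained from the link L by a t_k move: the disk of the move is put in
   the standard position, between the words u and v, by an isotopy. *)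
Definition t_move (k : nat) (L L' : diagram) : Prop :=
  exists u v i,
    [/\ closed (u ++ v), parallel (top u) i,
        isotopic L (u ++ v) & isotopic (u ++ twist k i ++ v) L'].

(* \bar t_k for even k: the directions recorded by u and v are kept. *)
Definition tbar_even_move (k : nat) (L L' : diagram) : Prop :=
  exists u v i,
    [/\ ~~ odd k, closed (u ++ v), antiparallel (top u) i,
        isotopic L (u ++ v) & isotopic (u ++ twist k i ++ v) L'].

(* Points of a diagram: (h, j) is the point j of the line above the first h
   pieces. *)
Definition point : Type := (nat * nat)%type.

(* [arc p (e, j) (e', j')]: the piece p joins the point j of the line below
   (e = false) or above (e = true) it to the point j' of the line e'. *)
Inductive arc : piece -> bool * nat -> bool * nat -> Prop :=
  | arc_left p j : j < pos p -> arc p (false, j) (true, j)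
  | arc_right p j : pos p + nin p <= j ->
      arc p (false, j) (true, j - nin p + nout p)
  | arc_cup i b : arc (Cup i b) (true, i) (true, i.+1)
  | arc_cap i : arc (Cap i) (false, i) (false, i.+1)
  | arc_cross_up c i : arc (Cross c i) (false, i) (true, i.+1)
  | arc_cross_down c i : arc (Cross c i) (false, i.+1) (true, i).

(* x and y lie on the same component of D. *)
Inductive connected (D : diagram) : point -> point -> Prop :=
  | conn_arc u p v (e e' : bool) j j' :
      D = u ++ p :: v -> arc p (e, j) (e', j') ->
      connected D (size u + e, j) (size u + e', j')
  | conn_refl x : connected D x x
  | conn_sym x y : connected D x y -> connected D y x
  | conn_trans x y z : connected D x y -> connected D y z -> connected D x z.

Definition direction (D : diagram) (x : point) : bool :=
  nth false (top (take x.1 D)) x.2.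

Definition unorient (D : diagram) : diagram :=
  [seq if p is Cup i _ then Cup i true else p | p <- D].

(* D and D' coincide as unoriented diagrams outside a disk, which lies above the
   first n pieces and consists of d pieces of D, resp. d' pieces of D'.  Outside
   the disk D' is oriented as D except on the part C of D, where the orientation
   is opposite. *)
Definition reversed_outside (n d : nat) (D : diagram) (d' : nat) (D' : diagram)
    (C : point -> Prop) : Prop :=
  let flip x x' :=
    (C x -> direction D' x' = ~~ direction D x) /\
    (~ C x -> direction D' x' = direction D x) in
  (forall h j, h <= n -> flip (h, j) (h, j)) /\
  (forall h j, flip (n + d + h, j) (n + d' + h, j)).

(* For L = u ++ v with antiparallel strands i, i+1 above u, the oriented diagram
   D' is \bar t_k(L), k odd, with one of the allowed orientations. *)
Definition tbar_odd_orientation (k : nat) (u v : diagram) (i : nat)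
    (D' : diagram) : Prop :=
  let n := size u in
  let L := u ++ v in
  let Linf := u ++ [:: Cap i; Cup i (nth false (top u) i)] ++ v in
  [/\ closed D', unorient D' = unorient (u ++ twist k i ++ v)
    & (~ connected L (n, i) (n, i.+1) /\
       exists2 x, x = (n, i) \/ x = (n, i.+1)
         & reversed_outside n 0 L k D' (connected L x))
   \/ (connected L (n, i) (n, i.+1) /\
       exists2 x, x = (n, i) \/ x = (n.+2, i)
         & reversed_outside n 2 Linf k D' (connected Linf x))].

Definition tbar_odd_move (k : nat) (L L' : diagram) : Prop :=
  exists u v i D',
    [/\ odd k, closed (u ++ v), antiparallel (top u) i,
        tbar_odd_orientation k u v i D'
      & isotopic L (u ++ v) /\ isotopic D' L'].

(* Main.v *)
Require Import Defs.
From mathcomp Require Import boolp zify ring.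

(** The three parts are of different nature.

    Parts (a) and (b) are local. The skein relation at the last crossing of a twist gives
    a recurrence for the values of the invariant along the twist: of second order, with
    characteristic roots [s ^+ 3] and [- s], if the strands are parallel
    ([parallel_twist]), and affine of first order with multiplier [t ^- 2] if they are
    antiparallel ([antiparallel_twist]). The conditions on [t] say that the [k]-th powers
    of the two roots, respectively the [k]-th power of the multiplier and 1, coincide
    ([second_order_recurrence], [affine_recurrence]).

    Part (c) compares diagrams whose orientations differ far from the disk, and no local
    argument relates them. It holds because the Jones polynomial is, up to a factor that
    depends on the signs of the crossings, a function of the unoriented diagram, namely
    Kauffman's bracket, in which a crossing is [B] times one smoothing plus [B^-1] times
    the other, with [t = B ^- 4]. In the bracket a twist has the two eigenvalues [B ^+ k]
    and [(- B ^- 3) ^+ k]; they agree exactly when [t ^+ k = (-1) ^+ k], and then the twist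
    is a scalar ([bracket_twist]). The factors coming from the crossings are powers of
    [- B ^+ 3]; as [(- B ^+ 3) ^+ (4 * k) = -1], a count of crossings modulo 2
    shows that the total factor is a [4 * k]-th root of unity ([kauffman_odd_twist]).

    This requires that the given invariant, evaluated at [s], is Kauffman's
    ([kauffman_unique]). The bracket is built as a product of operators, one for each
    piece, on functions of the labels of a horizontal line, and its invariance follows from
    the Temperley-Lieb relations. The uniqueness of a skein invariant amounts to a
    statement on the zero set of the difference of two of them ([skein_closed_all]). A
    tangle read from the bottom is reduced to layered ones, in which each arc lies above
    the previous ones: a piece put on top of a layered tangle either slides under the
    uppermost arc, where induction on the number of strands applies, or meets one of its
    ends, where an isotopy, possibly after the change of a crossing, restores a layered
    tangle. This replaces the usual induction on the number of crossings and the fact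
    that descending diagrams are trivial links. *)

Set Implicit Arguments.
Unset Strict Implicit.
Unset Printing Implicit Defensive.
Import GRing.Theory Num.Theory.

Local Open Scope nat_scope.

(** * Words read from an arbitrary line *)

Definition run_from (s : seq bool) (D : diagram) : option (seq bool) :=
  foldl (fun o p => obind (fun s => step s p) o) (Some s) D.

Lemma run_from_None D : foldl (fun o p => obind (fun s => step s p) o) None D = None.
Proof. by elim: D. Qed.

Lemma run_from_cons s p D :
  run_from s (p :: D) = obind (fun s' => run_from s' D) (step s p).
Proof. by rewrite /run_from /=; case: (step s p) => //=; rewrite run_from_None. Qed.

Lemma run_from_cat s D E :
  run_from s (D ++ E) = obind (fun s' => run_from s' E) (run_from s D).
Proof.
rewrite /run_from foldl_cat; case: (foldl _ (Some s) D) => //=; exact: run_from_None.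
Qed.

Lemma run_from_catP s D E s' : run_from s (D ++ E) = Some s' ->
  exists2 r, run_from s D = Some r & run_from r E = Some s'.
Proof. by rewrite run_from_cat; case: (run_from s D) => //= r; exists r. Qed.

Lemma run_from_consP s p E s' : run_from s (p :: E) = Some s' ->
  exists2 r, step s p = Some r & run_from r E = Some s'.
Proof. by rewrite run_from_cons; case: (step s p) => //= r; exists r. Qed.

Lemma run_from1 s p : run_from s [:: p] = step s p.
Proof. by []. Qed.

Lemma closedE D : closed D = (run_from [::] D == Some [::]).
Proof. by []. Qed.

Lemma top_run D s : run_from [::] D = Some s -> top D = s.
Proof. by rewrite /top /run -/(run_from _ _) => ->. Qed.

Definition shift (n : nat) (w : diagram) : diagram :=
  [seq set_pos p (n + pos p) | p <- w].

(** A piece does not see the strands to its left; this reduces every statement about a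
    word acting at position [i] to the same word at position 0. *)
Lemma step_shift l r p :
  step (l ++ r) (set_pos p (size l + pos p)) = omap (cat l) (step r p).
Proof.
case: p => [i b|i|c i] /=.
- rewrite size_cat leq_add2l; case: ifP => //= _.
  rewrite take_cat drop_cat !ltnNge leq_addr /= addKn.
  by rewrite -catA.
- rewrite drop_cat ltnNge leq_addr /= addKn.
  case: (drop i r) => [|x [|y s]] //=; case: ifP => //= _.
  by rewrite take_cat ltnNge leq_addr /= addKn catA.
- rewrite drop_cat ltnNge leq_addr /= addKn.
  case: (drop i r) => [|x [|y s]] //=.
  by rewrite take_cat ltnNge leq_addr /= addKn -catA.
Qed.

Lemma run_from_shift l r w :
  run_from (l ++ r) (shift (size l) w) = omap (cat l) (run_from r w).
Proof.
elim: w r => [|p w IH] r //=.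
rewrite !run_from_cons step_shift; case: (step r p) => //= r'; exact: IH.
Qed.

Lemma step_oversize s p : size s < pos p -> step s p = None.
Proof.
case: p => [i b|i|c i] /= h; first by rewrite leqNgt h.
- by rewrite (drop_oversize (ltnW h)).
- by rewrite (drop_oversize (ltnW h)).
Qed.

(** The directions, below and above a piece, of the strands that it touches. They do
    not depend on its position, so that [stepP] presents [step] as the replacement of
    one factor of the line by another. *)
Definition local (p : piece) (a a' : seq bool) : Prop :=
  match p with
  | Cup _ b => a = [::] /\ a' = [:: b; ~~ b]
  | Cap _ => (exists x, a = [:: x; ~~ x]) /\ a' = [::]
  | Cross _ _ => exists x y, a = [:: x; y] /\ a' = [:: y; x]
  end.

Lemma local_size p a a' : local p a a' -> size a = nin p /\ size a' = nout p.
Proof.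
by case: p => [i b [-> ->]|i [[x ->] ->]|c i [x [y [-> ->]]]].
Qed.

Lemma local_set_pos p j a a' : local (set_pos p j) a a' <-> local p a a'.
Proof. by case: p. Qed.

Lemma stepP s p s' : step s p = Some s' <->
  exists l a a' r, [/\ s = l ++ a ++ r, s' = l ++ a' ++ r, size l = pos p
                    & local p a a'].
Proof.
split.
- case: p => [i b|i|c i] /=.
  + case: ifP => // h [<-]; exists (take i s), [::], [:: b; ~~ b], (drop i s).
    by split=> //=; rewrite ?cat_take_drop // size_takel.
  + case E: (drop i s) => [|x [|y t]] //; case: ifP => // nxy [<-].
    exists (take i s), [:: x; y], [::], t; split=> //=.
    * by rewrite -E cat_take_drop.
    * rewrite size_takel // ltnW // -subn_gt0 -size_drop E //.
    * by split=> //; exists x; case: x y nxy {E} => [] [].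
  + case E: (drop i s) => [|x [|y t]] // [<-].
    exists (take i s), [:: x; y], [:: y; x], t; split=> //=.
    * by rewrite -E cat_take_drop.
    * rewrite size_takel // ltnW // -subn_gt0 -size_drop E //.
    * by exists x, y.
- case=> l [a [a' [r [-> -> hl]]]].
  case: p hl => [i b|i|c i] /= <-.
  + by case=> -> ->; rewrite size_cat leq_addr take_size_cat ?drop_size_cat.
  + case=> [[x ->] ->]; rewrite drop_size_cat //= take_size_cat //.
    by case: x.
  + by case=> x [y [-> ->]]; rewrite drop_size_cat //= take_size_cat.
Qed.

Lemma cat_inj_le (T : Type) (l1 l2 r1 r2 : seq T) :
  l1 ++ r1 = l2 ++ r2 -> size l1 <= size l2 ->
  exists2 m, l2 = l1 ++ m & r1 = m ++ r2.
Proof.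
elim: l1 l2 => [|x l1 IH] [|y l2] //=; first by move=> ->; exists [::].
- by move=> ->; exists (y :: l2).
- by case=> -> /IH{}IH /IH [m -> ->]; exists m.
Qed.

(** The two pieces replace disjoint factors of the line, hence in either order. *)
Lemma far_run_from p q s s' : pos p + nin p <= pos q ->
  run_from s [:: q; p] = Some s' <->
  run_from s [:: p; set_pos q (pos q - nin p + nout p)] = Some s'.
Proof.
move=> hpq; set q' := set_pos _ _.
have pq' : pos q' = pos q - nin p + nout p by rewrite /q'; case: (q).
split=> /run_from_consP [t h1]; rewrite run_from1 run_from_cons => h2.
- move/stepP: h1 => [l [a [a' [r [Es Et sl la]]]]].
  move/stepP: h2 => [l2 [b [b' [r2 [Et2 Es' sl2 lb]]]]].
  have [sb sb'] := local_size lb.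
  have [||m Em Er] := @cat_inj_le _ (l2 ++ b) l r2 (a' ++ r).
  + by rewrite -catA -Et2 -Et.
  + by rewrite size_cat sl2 sb sl.
  have -> : step s p = Some (l2 ++ b' ++ m ++ a ++ r).
    apply/stepP; exists l2, b, b', (m ++ a ++ r); split=> //.
    by rewrite Es Em -!catA.
  rewrite [LHS]/= run_from1.
  have -> : step (l2 ++ b' ++ m ++ a ++ r) q' = Some s'; last by [].
  apply/stepP; exists (l2 ++ b' ++ m), a, a', r; split.
  + by rewrite -!catA.
  + by rewrite Es' Er -!catA.
  + move: sl; rewrite Em pq' => <-; rewrite !size_cat sb sb'; lia.
  + by apply/local_set_pos.
- move/stepP: h1 => [l2 [b [b' [r2 [Es Et sl2 lb]]]]].
  move/stepP: h2 => [l [a [a' [r [Et2 Es' sl la]]]]].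
  have {}la : local q a a' by move: la; rewrite /q' => /local_set_pos.
  have [sb sb'] := local_size lb.
  have [||m Em Er] := @cat_inj_le _ (l2 ++ b') l r2 (a ++ r).
  + by rewrite -catA -Et -Et2.
  + rewrite size_cat sl2 sb' sl pq'; lia.
  have -> : step s q = Some (l2 ++ b ++ m ++ a' ++ r).
    apply/stepP; exists (l2 ++ b ++ m), a, a', r; split=> //.
    * by rewrite Es Er -!catA.
    * by rewrite -!catA.
    * move: sl; rewrite Em pq' !size_cat sb sb'; lia.
  rewrite [LHS]/= run_from1.
  have -> : step (l2 ++ b ++ m ++ a' ++ r) p = Some s'; last by [].
  apply/stepP; exists l2, b, b', (m ++ a' ++ r); split=> //.
  by rewrite Es' Em -!catA.
Qed.

(** The moves that are not distant commutations, at position 0. Their effect on a line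
    involves at most three strands and is found by computation; [moveE] says that
    every move is a translate of one of these. *)
Inductive move_at0 : diagram -> diagram -> Prop :=
  | m_zl b : move_at0 [:: Cup 1 b; Cap 0] [::]
  | m_zr b : move_at0 [:: Cup 0 b; Cap 1] [::]
  | m_scup c b : move_at0 [:: Cup 0 b; Cross c 1] [:: Cup 1 b; Cross (~~ c) 0]
  | m_scap c : move_at0 [:: Cross c 1; Cap 0] [:: Cross (~~ c) 0; Cap 1]
  | m_r1cup c b : move_at0 [:: Cup 0 b; Cross c 0] [:: Cup 0 (~~ b)]
  | m_r1cap c : move_at0 [:: Cross c 0; Cap 0] [:: Cap 0]
  | m_r2 c : move_at0 [:: Cross c 0; Cross (~~ c) 0] [::]
  | m_r3 a b c : (b == a) || (b == c) ->
      move_at0 [:: Cross a 0; Cross b 1; Cross c 0]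
            [:: Cross c 1; Cross b 0; Cross a 1].

Lemma moveE a b : move a b ->
  (exists p q, [/\ pos p + nin p <= pos q, a = [:: q; p]
      & b = [:: p; set_pos q (pos q - nin p + nout p)]]) \/
  (exists i a0 b0, [/\ move_at0 a0 b0, a = shift i a0 & b = shift i b0]).
Proof.
case.
- by move=> p q h; left; exists p, q.
- by move=> i d; right; exists i, [:: Cup 1 d; Cap 0], [::]; split;
    [constructor| rewrite /= addn0 addn1 | ].
- by move=> i d; right; exists i, [:: Cup 0 d; Cap 1], [::]; split;
    [constructor| rewrite /= addn0 addn1 | ].
- by move=> c i d; right; exists i, [:: Cup 0 d; Cross c 1],
    [:: Cup 1 d; Cross (~~ c) 0]; split;
    [constructor| rewrite /= addn0 addn1 | rewrite /= addn0 addn1].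
- by move=> c i; right; exists i, [:: Cross c 1; Cap 0],
    [:: Cross (~~ c) 0; Cap 1]; split;
    [constructor| rewrite /= addn0 addn1 | rewrite /= addn0 addn1].
- by move=> c i d; right; exists i, [:: Cup 0 d; Cross c 0], [:: Cup 0 (~~ d)];
    split; [constructor| rewrite /= addn0 | rewrite /= addn0].
- by move=> c i; right; exists i, [:: Cross c 0; Cap 0], [:: Cap 0];
    split; [constructor| rewrite /= addn0 | rewrite /= addn0].
- by move=> c i; right; exists i, [:: Cross c 0; Cross (~~ c) 0], [::];
    split; [constructor| rewrite /= addn0 | ].
- by move=> a' b' c i h; right; exists i, [:: Cross a' 0; Cross b' 1; Cross c 0],
    [:: Cross c 1; Cross b' 0; Cross a' 1]; split;
    [constructor| rewrite /= addn0 addn1 | rewrite /= addn0 addn1].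
Qed.

Lemma move_at0_run_from a b r s' : move_at0 a b ->
  (run_from r a = Some s' -> run_from r b = Some s') /\
  (b <> [::] -> run_from r b = Some s' -> run_from r a = Some s').
Proof.
by case=> > ; repeat match goal with x : bool |- _ => destruct x end;
  move=> //; rewrite /run_from;
  case: r => [|[] [|[] [|[] r]]] /=; split.
Qed.

Lemma shift_oversize s i w : size s < i -> w <> [::] -> run_from s (shift i w) = None.
Proof.
case: w => // p w h _; rewrite /= run_from_cons step_oversize //.
by case: p => * /=; apply: leq_trans h _; apply: leq_addr.
Qed.

(** A move does not change the line it leads to. The restriction in the second half is
    due to the empty word, which fits any line, whereas the two pieces cancelled by a
    zigzag or a second Reidemeister move need strands to act on. *)
Lemma move_run_from a b s s' : move a b ->
  (run_from s a = Some s' -> run_from s b = Some s') /\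
  (b <> [::] -> run_from s b = Some s' -> run_from s a = Some s').
Proof.
case/moveE=> [[p [q [h -> ->]]]|[i [a0 [b0 [h -> ->]]]]].
  by split=> [|_] hr; apply/(far_run_from _ _ h).
case: (leqP i (size s)) => hi.
  have := run_from_shift (take i s) (drop i s); rewrite cat_take_drop size_takel //.
  move=> E; rewrite !E.
  case: (run_from (drop i s) a0) (fun s1 => @move_at0_run_from a0 b0 (drop i s) s1 h)
    => [t|] H.
    have [/(_ erefl) -> _] := H t; split=> //.
  split=> // nb; case Eb: (run_from (drop i s) b0) => [t|] //.
  have [_] := H t; rewrite Eb => /(_ _ erefl) -> //.
  by move=> E0; apply: nb; rewrite E0.
have na : a0 <> [::] by case: h.
rewrite (shift_oversize hi na); split=> // nb.
by rewrite shift_oversize // => E0; apply: nb; rewrite E0.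
Qed.

Lemma step_crossP s c i s' : step s (Cross c i) = Some s' ->
  exists l x y r, [/\ s = l ++ [:: x, y & r], s' = l ++ [:: y, x & r],
    size l = i, nth false s i = x & nth false s i.+1 = y].
Proof.
case/stepP=> l [a [a' [r [-> -> /= <- [x [y [-> ->]]]]]]].
exists l, x, y, r; split=> //; first by rewrite nth_cat ltnn subnn.
by rewrite nth_cat ltnNge leqnSn subSnn.
Qed.

(** The oriented smoothing of a crossing of antiparallel strands leaves the same line
    as the crossing, so that the three diagrams of a skein triple are closed together.
    *)
Lemma smoothing_run_from s c i s' : step s (Cross c i) = Some s' ->
  nth false s i != nth false s i.+1 ->
  run_from s [:: Cap i; Cup i (nth false s i.+1)] = Some s'.
Proof.
move=> hs e; have [l [x [y [r [es es' hl hx hy]]]]] := step_crossP hs.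
have hc : step s (Cap i) = Some (l ++ r).
  apply/stepP; exists l, [:: x; y], [::], r; split=> //; split=> //.
  by move: e; rewrite hx hy; exists x; case: (x) (y) e => [] [].
rewrite run_from_cons hc [LHS]/= run_from1; apply/stepP.
exists l, [::], [:: y; x], r; split=> //; split=> //.
by move: e; rewrite hx hy; case: (x) (y) => [] [].
Qed.

(** * Isotopy of tangles *)

(** Isotopy of [a] to [b] inside any diagram whose line below [a] is [s]. It
    presupposes only that [a] fits [s]: thus all moves qualify from left to right
    without side conditions, and chains of moves can be composed without tracking the
    lines that occur between them. *)
Definition tangle_iso (s : seq bool) (a b : diagram) : Prop :=
  forall s', run_from s a = Some s' ->
    run_from s b = Some s' /\
    forall u v, run_from [::] u = Some s -> closed (u ++ a ++ v) ->
      closed (u ++ b ++ v) /\ isotopic (u ++ a ++ v) (u ++ b ++ v).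

Lemma tiso_refl s a : tangle_iso s a a.
Proof. by move=> s' h; split=> // u v _ c; split=> //; apply: iso_refl. Qed.

Lemma tiso_trans s a b c : tangle_iso s a b -> tangle_iso s b c -> tangle_iso s a c.
Proof.
move=> hab hbc s' ha; have [hb ab] := hab _ ha; have [hc bc] := hbc _ hb.
split=> // u v hu cl; have [cb iab] := ab u v hu cl.
have [cc ibc] := bc u v hu cb; split=> //; exact: iso_trans iab ibc.
Qed.

Lemma tiso_ctx s u a b v : (forall r, run_from s u = Some r -> tangle_iso r a b) ->
  tangle_iso s (u ++ a ++ v) (u ++ b ++ v).
Proof.
move=> h s' /run_from_catP [r hu /run_from_catP [t ha hv]].
have [hb ab] := h _ hu _ ha; split.
  by rewrite !run_from_cat hu /= run_from_cat hb.
move=> u0 v0 hu0; rewrite -!catA ![u0 ++ u ++ _]catA; apply: ab.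
by rewrite run_from_cat hu0.
Qed.

Lemma closed_subst u v a b s s' : run_from [::] u = Some s -> run_from s a = Some s' ->
  run_from s b = Some s' -> closed (u ++ a ++ v) -> closed (u ++ b ++ v).
Proof.
by move=> hu ha hb; rewrite !closedE !run_from_cat hu /= !run_from_cat ha hb.
Qed.

Lemma tiso_move s a b : move a b -> tangle_iso s a b.
Proof.
move=> m s' ha; have hb := (move_run_from s s' m).1 ha; split=> // u v hu cl.
have cl' := closed_subst hu ha hb cl.
by split=> //; apply: iso_move.
Qed.

Lemma tiso_back s a b : move a b -> b <> [::] -> tangle_iso s b a.
Proof.
move=> m nb s' hb; have ha := (move_run_from s s' m).2 nb hb; split=> // u v hu cl.
have cl' := closed_subst hu hb ha cl.
by split=> //; apply: iso_sym; apply: iso_move.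
Qed.

Lemma tiso_invert s s' a b : tangle_iso s a b -> run_from s a = Some s' -> tangle_iso s b a.
Proof.
move=> h ha t hb; have [hb' ab] := h _ ha.
have E : t = s' by move: hb; rewrite hb' => -[].
subst t; split=> // u v hu cl.
have cl' := closed_subst hu hb' ha cl.
by split=> //; apply: iso_sym; apply: (ab u v hu cl').2.
Qed.

(** The strand at position [i] runs to the right over the next [k] strands. *)
Definition over (i k : nat) : diagram := [seq Cross true j | j <- iota i k].

(** A new arc laid over the whole tangle: its left end is at position 0, its right end
    has [k] of the old strands to its left. *)
Definition arc_over (x : bool) (k : nat) : diagram := Cup 0 x :: over 1 k.

Lemma overS i k : over i k.+1 = Cross true i :: over i.+1 k.
Proof. by []. Qed.

Lemma over_cat i k l : over i (k + l) = over i k ++ over (i + k) l.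
Proof. by rewrite /over iotaD map_cat. Qed.

Lemma overSr i k : over i k.+1 = over i k ++ [:: Cross true (i + k)].
Proof. by rewrite -addn1 over_cat. Qed.

Lemma tiso_step s u a b v x y : x = u ++ a ++ v ->
  (forall r, run_from s u = Some r -> tangle_iso r a b) -> tangle_iso s (u ++ b ++ v) y ->
  tangle_iso s x y.
Proof. by move=> -> h; apply: tiso_trans; apply: tiso_ctx. Qed.

Lemma tiso_eq s a b : a = b -> tangle_iso s a b.
Proof. by move=> ->; apply: tiso_refl. Qed.

Lemma set_pos_id q : set_pos q (pos q) = q.
Proof. by case: q. Qed.

Lemma move_far p q j : pos p + nin p <= pos q -> j = pos q - nin p + nout p ->
  move [:: q; p] [:: p; set_pos q j].
Proof. by move=> h ->; apply: far. Qed.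

Lemma move_far_cross c m q : m.+1 < pos q -> move [:: q; Cross c m] [:: Cross c m; q].
Proof.
move=> h; rewrite -[in X in move _ X](set_pos_id q).
by apply: move_far => /=; rewrite ?addn2 ?subnK //; lia.
Qed.

Lemma tiso_over_right s i k q : i + k < pos q ->
  tangle_iso s (over i k ++ [:: q]) (q :: over i k).
Proof.
elim: k s q => [|k IH] s q h; first exact: tiso_refl.
rewrite overSr.
apply: (@tiso_step _ (over i k) [:: Cross true (i + k); q] [:: q; Cross true (i + k)] [::]).
- by rewrite -catA.
- by move=> r _; apply: tiso_back => //; apply: move_far_cross; lia.
apply: (@tiso_step _ [::] (over i k ++ [:: q]) (q :: over i k) [:: Cross true (i + k)]).
- by rewrite -catA.
- by move=> r _; apply: IH; lia.
- exact: tiso_refl.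
Qed.

Lemma tiso_over_left s i j k q : pos q + nin q <= i -> j = i - nin q + nout q ->
  tangle_iso s (over i k ++ [:: q]) (q :: over j k).
Proof.
elim: k s i j => [|k IH] s i j h ej; first exact: tiso_refl.
rewrite overS.
apply: (@tiso_step _ [:: Cross true i] (over i.+1 k ++ [:: q]) (q :: over j.+1 k) [::]).
- by rewrite cats0.
- by move=> r _; apply: IH; lia.
apply: (@tiso_step _ [::] [:: Cross true i; q] [:: q; Cross true j] (over j.+1 k)).
- by rewrite cats0.
- by move=> r _; apply: tiso_move; apply: (@move_far q (Cross true i) j).
- exact: tiso_refl.
Qed.

(** What happens to the right of the arc happens before the arc is laid. *)
Lemma tiso_arc_right s x k q j : k.+1 < pos q -> pos q = j.+2 ->
  tangle_iso s (arc_over x k ++ [:: q]) (set_pos q j :: arc_over x k).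
Proof.
move=> h e.
apply: (@tiso_step _ [:: Cup 0 x] (over 1 k ++ [:: q]) (q :: over 1 k) [::]).
- by rewrite cats0.
- by move=> r _; apply: tiso_over_right; lia.
apply: (@tiso_step _ [::] [:: Cup 0 x; q] [:: set_pos q j; Cup 0 x] (over 1 k)).
- by rewrite cats0.
- move=> r _; apply: tiso_back => //.
  have E : q = set_pos (set_pos q j) j.+2 by rewrite -e; case: (q).
  rewrite [X in move _ [:: _; X]]E.
  by apply: move_far; case: (q) => //= *; lia.
- exact: tiso_refl.
Qed.

(** Read backwards, this exhibits the ends of the uppermost arc in a given line. *)
Lemma arc_over_state s x k s' : run_from s (arc_over x k) = Some s' ->
  exists s1 s2, [/\ size s1 = k, s = s1 ++ s2 & s' = x :: s1 ++ ~~ x :: s2].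
Proof.
elim: k s' => [|k IH] s'.
  by move=> [<-]; exists [::], s; rewrite take0 drop0.
rewrite /arc_over overSr -[_ :: _]/(arc_over x k ++ _) => /run_from_catP [t].
move=> /IH [s1 [s2 [h1 h2 ->]]]; rewrite run_from1 add1n => /stepP.
case=> l [a [a' [r [e -> hl]]]] [y [z [ea ->]]]; move: e hl; rewrite {}ea.
case: l => // x' l [<- {x'}] e [hl].
have [hl1 hr] : s1 = l /\ ~~ x :: s2 = [:: y; z] ++ r.
  by move/eqP: e; rewrite eqseq_cat ?h1 // => /andP [/eqP -> /eqP ->].
case: hr => <- hs; exists (rcons s1 z), r; split.
- by rewrite size_rcons h1.
- by rewrite h2 hs cat_rcons.
- by rewrite -hl1 cat_rcons.
Qed.

(** A local minimum to the left of an upright strand can be pulled out on its right,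
    passing beneath the strand. With [i] the position of the strand, this is a second
    Reidemeister move between the strand and the right leg, followed by sliding the
    overstrand across the minimum. *)
Lemma tiso_cup_under s i b : i < size s ->
  tangle_iso s [:: Cup i b] [:: Cup i.+1 b; Cross true i; Cross true i.+1].
Proof.
move=> h; have e : run_from s [:: Cup i.+1 b; Cross true i; Cross true i.+1] =
    run_from s [:: Cup i b].
  have := run_from_shift (take i s) (drop i s); rewrite cat_take_drop size_takel 1?ltnW //.
  move=> E; have := E [:: Cup 1 b; Cross true 0; Cross true 1].
  rewrite /= !addn0 !addn1 => ->.
  have := E [:: Cup 0 b]; rewrite /= !addn0 => ->.
  case: (drop i s) (size_drop i s) => [/= hd|y r _]; first by lia.
  by rewrite /run_from /= ?take0 ?drop0.
have R : tangle_iso s [:: Cup i.+1 b; Cross true i; Cross true i.+1] [:: Cup i b].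
  apply: (@tiso_step _ [::] [:: Cup i.+1 b; Cross true i]
           [:: Cup i b; Cross false i.+1] [:: Cross true i.+1]) => //.
    by move=> r _; apply: tiso_back => //; apply: (slide_cup false).
  apply: (@tiso_step _ [:: Cup i b] [:: Cross false i.+1; Cross true i.+1]
           [::] [::]) => //; last exact: tiso_refl.
  by move=> r _; apply: tiso_move; apply: (reidemeister2 false).
have [s' h'] : exists s', run_from s [:: Cup i b] = Some s'.
  by rewrite run_from1 /= ltnW //; eexists.
by apply: (tiso_invert R (s' := s')); rewrite e.
Qed.

(** * Sliding a piece past an overlying arc *)

Lemma arc_over_cat x k l : arc_over x (k + l) = arc_over x k ++ over k.+1 l.
Proof. by rewrite /arc_over over_cat. Qed.

(** A minimum created between the two ends of the top arc is pulled under the arc and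
    then precedes it; the arc now passes over two more strands. *)
Lemma tiso_arc_cup s x k i b : i <= k ->
  tangle_iso s (arc_over x k ++ [:: Cup i.+1 b]) (Cup i b :: arc_over x k.+2).
Proof.
move=> h; have [l ->] : exists l, k = i + l by exists (k - i); lia.
rewrite arc_over_cat.
apply: (@tiso_step _ (arc_over x i) (over i.+1 l ++ [:: Cup i.+1 b])
                    (Cup i.+1 b :: over i.+3 l) [::]).
- by rewrite cats0 catA.
- by move=> r _; apply: tiso_over_left => /=; lia.
apply: (@tiso_step _ (arc_over x i) [:: Cup i.+1 b]
          [:: Cup i.+2 b; Cross true i.+1; Cross true i.+2] (over i.+3 l)).
- by rewrite cats0.
- move=> r /arc_over_state [s1 [s2 [h1 _ ->]]]; apply: tiso_cup_under.
  by rewrite /= size_cat /=; lia.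
apply: (@tiso_step _ [::] (arc_over x i ++ [:: Cup i.+2 b])
          (Cup i b :: arc_over x i) (over i.+1 l.+2)).
- by rewrite /= -catA.
- by move=> r _; apply: (@tiso_arc_right _ x i (Cup i.+2 b) i).
by apply: tiso_eq; rewrite -!addnS arc_over_cat.
Qed.

(** A crossing between the two ends of the top arc slides under it by a third
    Reidemeister move, whatever its sign, because the arc is over both strands. *)
Lemma tiso_arc_cross s x k c i : i <= k ->
  tangle_iso s (arc_over x k.+2 ++ [:: Cross c i.+1]) (Cross c i :: arc_over x k.+2).
Proof.
move=> h; have [l ->] : exists l, k = i + l by exists (k - i); lia.
rewrite -!addnS arc_over_cat.
apply: (@tiso_step _ (arc_over x i ++ [:: Cross true i.+1; Cross true i.+2])
          (over i.+3 l ++ [:: Cross c i.+1])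
                    (Cross c i.+1 :: over i.+3 l) [::]).
- by rewrite cats0 /= -!catA.
- by move=> r _; apply: tiso_over_left => /=; lia.
apply: (@tiso_step _ (arc_over x i)
          [:: Cross true i.+1; Cross true i.+2; Cross c i.+1]
          [:: Cross c i.+2; Cross true i.+1; Cross true i.+2] (over i.+3 l)).
- by rewrite cats0 /= -!catA.
- by move=> r _; apply: tiso_move; apply: reidemeister3.
apply: (@tiso_step _ [::] (arc_over x i ++ [:: Cross c i.+2])
          (Cross c i :: arc_over x i) (over i.+1 l.+2)).
- by rewrite /= -catA.
- by move=> r _; apply: (@tiso_arc_right _ x i (Cross c i.+2) i).
exact: tiso_refl.
Qed.

(** The passage of the arc over the two joined strands slides across the maximum,
    after which its two crossings cancel. *)
Lemma tiso_arc_cap s x k i : i <= k ->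
  tangle_iso s (arc_over x k.+2 ++ [:: Cap i.+1]) (Cap i :: arc_over x k).
Proof.
move=> h; have [l ->] : exists l, k = i + l by exists (k - i); lia.
rewrite -!addnS arc_over_cat.
apply: (@tiso_step _ (arc_over x i ++ [:: Cross true i.+1; Cross true i.+2])
          (over i.+3 l ++ [:: Cap i.+1]) (Cap i.+1 :: over i.+1 l) [::]).
- by rewrite cats0 /= -!catA.
- by move=> r _; apply: tiso_over_left => /=; lia.
apply: (@tiso_step _ (arc_over x i ++ [:: Cross true i.+1])
          [:: Cross true i.+2; Cap i.+1]
          [:: Cross false i.+1; Cap i.+2] (over i.+1 l)).
- by rewrite cats0 /= -!catA.
- by move=> r _; apply: tiso_move; apply: (slide_cap true).
apply: (@tiso_step _ (arc_over x i)
          [:: Cross true i.+1; Cross false i.+1] [::] (Cap i.+2 :: over i.+1 l)).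
- by rewrite /= -!catA.
- by move=> r _; apply: tiso_move; apply: (reidemeister2 true).
apply: (@tiso_step _ [::] (arc_over x i ++ [:: Cap i.+2])
          (Cap i :: arc_over x i) (over i.+1 l)).
- by rewrite /= -catA.
- by move=> r _; apply: (@tiso_arc_right _ x i (Cap i.+2) i).
by apply: tiso_eq; rewrite arc_over_cat.
Qed.

(** The strand at position [k] runs to position 0. The letters [false] make it the
    overstrand, as a strand running from lower right to upper left. *)
Fixpoint over_left (k : nat) : diagram :=
  if k is k'.+1 then Cross false k' :: over_left k' else [::].

(** Joining the right end of the top arc to the strand on its right has the same
    effect as pulling that strand along the arc to position 0. *)
Lemma tiso_arc_cap_last s x k :
  tangle_iso s (arc_over x k ++ [:: Cap k.+1]) (over_left k).
Proof.
elim: k s => [|k IH] s; first by apply: tiso_move; apply: zigzag_right.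
rewrite -addn1 arc_over_cat.
apply: (@tiso_step _ (arc_over x k) [:: Cross true k.+1; Cap k.+2]
          [:: Cross false k.+2; Cap k.+1] [::]).
- by rewrite addn1 /= -!catA.
- by move=> r _; apply: tiso_back => //; apply: (slide_cap false).
apply: (@tiso_step _ [::] (arc_over x k ++ [:: Cross false k.+2])
          (Cross false k :: arc_over x k) [:: Cap k.+1]).
- by rewrite /= -!catA.
- by move=> r _; apply: (@tiso_arc_right _ x k (Cross false k.+2) k).
apply: (@tiso_step _ [:: Cross false k] (arc_over x k ++ [:: Cap k.+1])
          (over_left k) [::]).
- by rewrite /= cats0.
- by move=> r _; apply: IH.
by apply: tiso_eq; rewrite /= cats0 addn1.
Qed.

(** The right end of the arc crosses the strand on its left just before it is joined
    to it; a first Reidemeister move removes this kink. *)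
Lemma tiso_arc_cap_prev s x k :
  tangle_iso s (arc_over x k.+1 ++ [:: Cap k.+1]) (over_left k).
Proof.
apply: (@tiso_step _ (arc_over x k) [:: Cross true k.+1; Cap k.+1]
          [:: Cap k.+1] [::]).
- by rewrite -[k.+1 in LHS]addn1 arc_over_cat addn1 /= -!catA.
- by move=> r _; apply: tiso_move; apply: reidemeister1_cap.
exact: tiso_arc_cap_last.
Qed.

(** Joining the left end of the arc to the next strand lets this strand run along the
    arc to the place of its right end, over all others. *)
Lemma tiso_arc_cap0 s x k : tangle_iso s (arc_over x k.+1 ++ [:: Cap 0]) (over 0 k).
Proof.
apply: (@tiso_step _ [:: Cup 0 x; Cross true 1] (over 2 k ++ [:: Cap 0])
         (Cap 0 :: over 0 k) [::]).
- by rewrite /= cats0.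
- by move=> r _; apply: tiso_over_left.
apply: (@tiso_step _ [::] [:: Cup 0 x; Cross true 1]
         [:: Cup 1 x; Cross false 0] (Cap 0 :: over 0 k)).
- by rewrite /= cats0.
- by move=> r _; apply: tiso_move; apply: (slide_cup true).
apply: (@tiso_step _ [:: Cup 1 x] [:: Cross false 0; Cap 0] [:: Cap 0] (over 0 k)) => //.
- by move=> r _; apply: tiso_move; apply: reidemeister1_cap.
apply: (@tiso_step _ [::] [:: Cup 1 x; Cap 0] [::] (over 0 k)) => //.
- by move=> r _; apply: tiso_move; apply: zigzag_left.
exact: tiso_refl.
Qed.

(** Moving the strand at position 1 to position 0 amounts to starting the arc to its
    right. The arc is no longer laid from the left end of the line, which is what
    [absorbs_cross0] repairs. *)
Lemma tiso_arc_cross0 s x k :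
  tangle_iso s (arc_over x k.+1 ++ [:: Cross true 0]) (Cup 1 x :: over 2 k).
Proof.
apply: (@tiso_step _ [:: Cup 0 x; Cross true 1] (over 2 k ++ [:: Cross true 0])
         (Cross true 0 :: over 2 k) [::]).
- by rewrite /= cats0.
- by move=> r _; apply: tiso_over_left.
apply: (@tiso_step _ [::] [:: Cup 0 x; Cross true 1]
         [:: Cup 1 x; Cross false 0] (Cross true 0 :: over 2 k)).
- by rewrite /= cats0.
- by move=> r _; apply: tiso_move; apply: (slide_cup true).
apply: (@tiso_step _ [:: Cup 1 x] [:: Cross false 0; Cross true 0] [::] (over 2 k)) => //.
- by move=> r _; apply: tiso_move; apply: (reidemeister2 false).
exact: tiso_refl.
Qed.

Lemma tiso_arc_cross_prev s x k :
  tangle_iso s (arc_over x k.+1 ++ [:: Cross false k.+1]) (arc_over x k).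
Proof.
apply: (@tiso_step _ (arc_over x k) [:: Cross true k.+1; Cross false k.+1]
          [::] [::]).
- by rewrite -[k.+1 in LHS]addn1 arc_over_cat addn1 /= -!catA.
- by move=> r _; apply: tiso_move; apply: (reidemeister2 true).
by apply: tiso_eq; rewrite /= cats0.
Qed.

(** * Layered tangles generate the skein *)

(** Normal forms of tangles: the strands are arcs stacked above one another, each laid
    over the previous ones with its left end leftmost. *)
Inductive layered : seq bool -> diagram -> Prop :=
  | layered_nil : layered [::] [::]
  | layered_arc s x k w s' : layered s w -> run_from s (arc_over x k) = Some s' ->
      layered s' (w ++ arc_over x k).

Lemma layered_run s w : layered s w -> run_from [::] w = Some s.
Proof.
by elim=> // {w}r x k w s' _ h e; rewrite run_from_cat h.
Qed.

(** The properties of the zero set of a link invariant satisfying a skein relation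
    with invertible coefficients: when it contains the smoothing, it contains both or
    none of the two crossings. The last two fields are the value of a split unknot and
    the value 0 of the empty diagram. *)
Record skein_closed (P : diagram -> Prop) : Prop := SkeinClosed {
  sc_isotopic D D' : closed D -> isotopic D D' -> P D -> P D';
  sc_switch Lp Lm L0 : skein_triple Lp Lm L0 -> P L0 -> P Lp <-> P Lm;
  sc_circle u v x : closed (u ++ v) -> P (u ++ v) ->
    P (u ++ [:: Cup 0 x; Cap 0] ++ v);
  sc_empty : P [::] }.

(** In linear terms: the functional that [v] defines on the tangles below it vanishes
    on the normal forms. *)
Definition completes (P : diagram -> Prop) s v : Prop :=
  run_from s v = Some [::] /\ forall w, layered s w -> P (w ++ v).

(** In linear terms: appending [p] to a normal form yields a combination of normal
    forms. The dual formulation avoids linear combinations of words. *)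
Definition absorbs (P : diagram -> Prop) s p : Prop :=
  forall s' v, step s p = Some s' -> completes P s' v -> completes P s (p :: v).

Lemma completes_run_from P s s' a v : run_from s a = Some s' -> completes P s' v ->
  run_from s (a ++ v) = Some [::].
Proof. by move=> h [hv _]; rewrite run_from_cat h. Qed.

Lemma completes_tiso P s w s' a b v : skein_closed P -> layered s w -> tangle_iso s a b ->
  run_from s a = Some s' -> run_from s' v = Some [::] ->
  (run_from s b = Some s' -> P (w ++ b ++ v)) -> P (w ++ a ++ v).
Proof.
move=> hP hw hab ha hv h; have [hb iso] := hab _ ha.
have hw' := layered_run hw.
have cl : closed (w ++ a ++ v).
  by rewrite closedE !run_from_cat hw' /= run_from_cat ha /= hv.
have [cl' i] := iso _ _ hw' cl.
by apply: (sc_isotopic hP cl' (iso_sym i)); apply: h.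
Qed.

Lemma completes_arc P s x k s' v : run_from s (arc_over x k) = Some s' ->
  completes P s' v -> completes P s (arc_over x k ++ v).
Proof.
move=> h hv; split; first exact: completes_run_from h hv.
move=> w hw; rewrite catA; apply: hv.2; exact: layered_arc hw h.
Qed.

(** If a piece can be pushed under the top arc, it acts on a tangle with fewer
    strands, and laying the arc afterwards preserves normal forms. *)
Lemma absorbs_descend P s0 w0 x k s p q x' k' s' v : skein_closed P ->
  layered s0 w0 -> run_from s0 (arc_over x k) = Some s -> step s p = Some s' ->
  tangle_iso s0 (arc_over x k ++ [:: p]) (q :: arc_over x' k') ->
  absorbs P s0 q -> completes P s' v -> P ((w0 ++ arc_over x k) ++ p :: v).
Proof.
move=> hP hw h hp hred hq hv.
rewrite -catA -cat1s [_ ++ [:: p] ++ v]catA.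
apply: (completes_tiso (s' := s') hP hw hred); first by rewrite run_from_cat h.
  exact: hv.1.
move=> /run_from_consP [r h1 h2].
by apply: (hq _ (arc_over x' k' ++ v) h1 (completes_arc h2 hv)).2.
Qed.

Lemma size_arc s x k s' : run_from s (arc_over x k) = Some s' -> size s' = (size s).+2.
Proof.
by move=> /arc_over_state [s1 [s2 [_ -> ->]]]; rewrite /= !size_cat /= addnS.
Qed.

(** A minimum at position 0 is a new top arc; any other one is pushed under the top
    arc. *)
Lemma absorbs_cup P s i b : skein_closed P -> absorbs P s (Cup i b).
Proof.
move=> hP; have [n] := ubnP (size s); elim: n s i => // n IH s i hn s' v hs hv.
split; first by rewrite run_from_cons hs; exact: hv.1.
move=> w hw; case: i hs => [|i] hs.
  rewrite -cat1s catA; apply: hv.2; exact: (@layered_arc s b 0 w s').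
case: hw hn hs => // s0 x k w0 s1 hw h hn hs.
have hs0 := size_arc h.
case: (leqP i k) => hi.
  apply: (absorbs_descend hP hw h hs (@tiso_arc_cup s0 x k i b hi) _ hv).
  by apply: IH; lia.
case: i hi hs => // i hi hs.
have hred := @tiso_arc_right s0 x k (Cup i.+2 b) i hi erefl.
apply: (absorbs_descend hP hw h hs hred _ hv).
by apply: IH; lia.
Qed.

Lemma step_cross_size s c i s' : step s (Cross c i) = Some s' -> size s' = size s.
Proof.
case/stepP=> l [a [a' [r [-> -> _ [x [y [-> ->]]]]]]].
by rewrite !size_cat.
Qed.

Lemma completes_over P s m i k s' v :
  (forall t c j, m <= j -> size t = size s -> absorbs P t (Cross c j)) ->
  m <= i -> run_from s (over i k) = Some s' -> completes P s' v ->
  completes P s (over i k ++ v).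
Proof.
elim: k s i => [|k IH] s i H mi; first by move=> [->].
move=> /run_from_consP [t h1 h2] hv; apply: (H s true i mi erefl _ _ h1).
apply: IH h2 hv; last by lia.
by move=> r c j mj; rewrite (step_cross_size h1); apply: H.
Qed.

Lemma completes_over_left P s k s' v :
  (forall t c j, size t = size s -> absorbs P t (Cross c j)) ->
  run_from s (over_left k) = Some s' -> completes P s' v -> completes P s (over_left k ++ v).
Proof.
elim: k s => [|k IH] s H; first by move=> [->].
move=> /run_from_consP [t h1 h2] hv; apply: (H s false k erefl _ _ h1).
apply: IH h2 hv.
by move=> r c j; rewrite (step_cross_size h1); apply: H.
Qed.

(** By the skein relation, the sign of a crossing above a normal form may be chosen,
    as its smoothing is either the normal form itself or obtained from it by a maximum
    and a minimum. *)
Lemma crossing_switch P s c i w v s' : skein_closed P -> layered s w ->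
  step s (Cross c i) = Some s' -> completes P s' v -> absorbs P s (Cap i) ->
  P (w ++ Cross (~~ c) i :: v) -> P (w ++ Cross c i :: v).
Proof.
move=> hP hw hs hv hcap.
have hcl : closed (w ++ [:: Cross true i] ++ v).
  rewrite closedE run_from_cat (layered_run hw) /= run_from_cons.
  by rewrite (_ : step s _ = step s (Cross c i)) // hs /= hv.1.
have ht := top_run (layered_run hw).
have [l [x [y [r [es es' hl hx hy]]]]] := step_crossP hs.
have hi : i.+1 < size s by rewrite es size_cat /= -hl; lia.
case: (eqVneq x y) => xy.
  have hpar : parallel (top w) i by rewrite /parallel ht hi hx hy xy /=.
  have P0 : P (w ++ v) by apply: hv.2; rewrite es' -xy {2}xy -es.
  by have := sc_switch hP (skein_parallel hpar hcl) P0; case: c {hs} => /= -[h1 h2].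
have nxy : nth false s i != nth false s i.+1 by rewrite hx hy.
have hpar : antiparallel (top w) i by rewrite /antiparallel ht hi nxy.
have P0 : P (w ++ [:: Cap i; Cup i (nth false (top w) i.+1)] ++ v).
  have [u hcap1 hcup] := run_from_consP (smoothing_run_from hs nxy).
  by rewrite ht; apply: (hcap _ _ hcap1 (absorbs_cup hP hcup hv)).2.
by have := sc_switch hP (skein_antiparallel hpar hcl) P0; case: c {hs} => /= -[h1 h2].
Qed.

(** A maximum that meets the top arc removes it and leaves crossings on a smaller
    tangle, unless it closes the arc to a circle. *)
Lemma absorbs_cap P s i : skein_closed P ->
  (forall t, size t < size s ->
     (forall j, absorbs P t (Cap j)) /\ (forall c j, absorbs P t (Cross c j))) ->
  absorbs P s (Cap i).
Proof.
move=> hP IH s' v hs hv.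
split; first by rewrite run_from_cons hs; exact: hv.1.
move=> w hw; case: hw IH hs => [_|s0 x k w0 s1 hw h IH hs]; first by case: i.
have hs0 : size s0 < size s1 by rewrite (size_arc h).
have [IHcap IHcross] := IH s0 hs0.
have hr : run_from s0 (arc_over x k ++ [:: Cap i]) = Some s' by rewrite run_from_cat h.
have E b : tangle_iso s0 (arc_over x k ++ [:: Cap i]) b ->
  (run_from s0 b = Some s' -> completes P s0 (b ++ v)) ->
  P ((w0 ++ arc_over x k) ++ Cap i :: v).
  move=> hred hb; rewrite -catA -cat1s [_ ++ _ ++ v]catA.
  apply: (completes_tiso hP hw hred hr hv.1) => h'; by apply: (hb h').2.
case: i hs hr E => [|i] hs hr E.
  case: k h hs hr E => [|k] h hs hr E.
    have e : s0 = s'.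
      have [l [s2 [/size0nil -> e1 e2]]] := arc_over_state h.
      by move: hs; rewrite e2 e1 /=; case: (x) => -[].
    rewrite -catA; apply: sc_circle => //; last by rewrite -e in hv; apply: hv.2.
    by rewrite closedE run_from_cat (layered_run hw) /= e hv.1.
  apply: (E _ (@tiso_arc_cap0 s0 x k)) => h'.
  by apply: completes_over (leqnn 0) h' hv => t c j _ ht; have [] := IH t; rewrite ?ht.
have hu k' : run_from s0 (over_left k') = Some s' -> completes P s0 (over_left k' ++ v).
  by move=> h'; apply: completes_over_left h' hv => t c j ht; have [] := IH t; rewrite ?ht.
case: (ltngtP i k) => hi.
- case: (ltngtP i.+1 k) => hi'; first last.
  + by subst k; apply: (E _ (@tiso_arc_cap_prev s0 x i)); apply: hu.
  + by lia.
  case: k hi hi' h hs hr {E} => // -[//|k] hi hi' h hs hr.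
  by apply: (absorbs_descend hP hw h hs (@tiso_arc_cap s0 x k i _) _ hv).
- case: i hi hs hr {E} => // i hi hs hr.
  have hred := @tiso_arc_right s0 x k (Cap i.+2) i hi erefl.
  by apply: (absorbs_descend hP hw h hs hred _ hv).
- by subst k; apply: (E _ (@tiso_arc_cap_last s0 x i)); apply: hu.
Qed.

(** A crossing away from position 0 either slides under the top arc or involves its
    right end. In the latter case one of its two signs lengthens or shortens the arc,
    and the other sign is related to it by the skein relation. *)
Lemma absorbs_crossS P s c i : skein_closed P ->
  (forall t, size t < size s -> forall c j, absorbs P t (Cross c j)) ->
  (forall j, absorbs P s (Cap j)) ->
  absorbs P s (Cross c i.+1).
Proof.
move=> hP IH hcap s' v hs hv.
split; first by rewrite run_from_cons hs; exact: hv.1.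
move=> w hw; case: hw IH hcap hs => [_ _|s0 x k w0 s1 hw h IH hcap hs] //.
have hs0 : size s0 < size s1 by rewrite (size_arc h).
have IHcross := IH s0 hs0.
have hw1 := layered_arc hw h.
have sw (d : bool) : (c = d -> P ((w0 ++ arc_over x k) ++ Cross d i.+1 :: v)) ->
    (c = ~~ d -> P ((w0 ++ arc_over x k) ++ Cross d i.+1 :: v)) ->
    P ((w0 ++ arc_over x k) ++ Cross c i.+1 :: v).
  move=> H1 H2; case: (eqVneq c d) => [cd|cd]; first by rewrite cd; apply: H1.
  have e : c = ~~ d by case: (c) (d) cd => [] [].
  apply: (crossing_switch hP hw1 hs hv (hcap _)); rewrite e negbK; exact: H2.
case: (ltngtP i k) => hi.
- case: (ltngtP i.+1 k) => hi'; first last.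
  + subst k.
    have H : P ((w0 ++ arc_over x i.+1) ++ Cross false i.+1 :: v).
      rewrite -catA -cat1s [_ ++ _ ++ v]catA.
      apply: (completes_tiso hP hw (@tiso_arc_cross_prev s0 x i) _ hv.1) => [|h'].
        by rewrite run_from_cat h.
      by apply: (completes_arc h' hv).2.
    exact: (sw false).
  + by lia.
  case: k hi hi' h hs hw1 {sw} => // -[//|k] hi hi' h hs hw1.
  have hik : i <= k by lia.
  exact: (absorbs_descend hP hw h hs (@tiso_arc_cross s0 x k c i hik) (IHcross _ _) hv).
- case: i hi hs {sw} => // i hi hs.
  have hred := @tiso_arc_right s0 x k (Cross c i.+2) i hi erefl.
  exact: (absorbs_descend hP hw h hs hred (IHcross _ _) hv).
- subst k.
  have e : arc_over x i ++ [:: Cross true i.+1] = arc_over x i.+1.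
    by rewrite -[in RHS]addn1 arc_over_cat.
  have H : P ((w0 ++ arc_over x i) ++ Cross true i.+1 :: v).
    rewrite -catA -cat1s [_ ++ _ ++ v]catA e catA; apply: hv.2.
    by apply: (layered_arc hw); rewrite -e run_from_cat h.
  exact: (sw true).
Qed.

(** Unless the crossing is a kink in the top arc, the left ends of the two top arcs
    are exchanged, so the layers must be exchanged as well. With the sign of
    [tiso_arc_cross0], the upper arc starts with a minimum that can be pulled beneath
    the second arc and becomes the layer below it; the second arc is then on top, and
    what is left of the upper arc is a sequence of crossings away from position 0. *)
Lemma absorbs_cross0 P s c : skein_closed P ->
  (forall j, absorbs P s (Cap j)) ->
  (forall t c j, size t = size s -> absorbs P t (Cross c j.+1)) ->
  absorbs P s (Cross c 0).
Proof.
move=> hP hcap hcross s' v hs hv.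
split; first by rewrite run_from_cons hs; exact: hv.1.
move=> w hw; case: hw hcap hcross hs => [_ _|s0 x k w0 s1 hw h hcap hcross hs] //.
have hw1 := layered_arc hw h.
case: k h hs hw1 => [|k] h hs hw1.
  rewrite -catA; apply: (@completes_tiso _ _ _ s' [:: Cup 0 x; Cross c 0]
    [:: Cup 0 (~~ x)] v hP hw) => //.
  + by apply: tiso_move; apply: reidemeister1_cup.
  + by rewrite run_from_cons; move: h; rewrite /= => -[->].
  + exact: hv.1.
  + by move=> h'; apply: (@completes_arc P s0 (~~ x) 0 s' v h' hv).2.
have H : P ((w0 ++ arc_over x k.+1) ++ Cross true 0 :: v); last first.
  case: c hs => // hs; exact: (crossing_switch hP hw1 hs hv (hcap _)).
have {}hs : run_from s0 (arc_over x k.+1 ++ [:: Cross true 0]) = Some s'.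
  by rewrite run_from_cat h.
rewrite -catA -cat1s [_ ++ _ ++ v]catA.
apply: (completes_tiso hP hw (@tiso_arc_cross0 s0 x k) hs hv.1).
have hs0 : size s1 = (size s0).+2 := size_arc h.
case: hw h hs hs0 {hw1} => [|r y l w1 s2 hw h2] h hs hs0.
  by have [[|??] [s2 []]] := arc_over_state h.
move=> /run_from_consP [t ht hov].
have hc : run_from r (arc_over y l ++ [:: Cup 1 x]) = Some t.
  by rewrite run_from_cat h2.
have hsz : size t = size s1.
  rewrite hs0; case/stepP: ht => l1 [a [a' [r1 [-> -> _ [-> ->]]]]].
  by rewrite !size_cat /=; lia.
rewrite -catA cat_cons -cat1s [arc_over y l ++ _]catA.
have kt : completes P t (over 2 k ++ v).
  apply: (@completes_over P t 1 2 k s') => // t' c' [|j] // _ e.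
  by apply: hcross; rewrite e.
apply: (completes_tiso hP hw (@tiso_arc_cup r y l 0 x (leq0n _)) hc kt.1).
move=> /run_from_consP [q hq1 hq2].
have hq : layered q (w1 ++ arc_over x 0) by apply: layered_arc hw _.
have := kt.2 _ (layered_arc hq hq2).
by rewrite -!catA.
Qed.

(** Induction on the number of strands. For a given number, maxima come first, because
    smoothings use them, then crossings away from position 0, then those at position
    0. *)
Lemma absorbs_piece P s p : skein_closed P -> absorbs P s p.
Proof.
move=> hP.
suff H n : forall s, size s < n ->
    (forall j, absorbs P s (Cap j)) /\ (forall c j, absorbs P s (Cross c j)).
  have [hcap hcross] := H (size s).+1 s (leqnn _).
  by case: p => [i b|i|c i] //; apply: absorbs_cup.
elim: n => // n IH {}s hn.
have IH' t : size t < size s -> (forall j, absorbs P t (Cap j)) /\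
    (forall c j, absorbs P t (Cross c j)) by move=> h; apply: IH; lia.
have Hcap t : size t = size s -> forall j, absorbs P t (Cap j).
  by move=> e j; apply: absorbs_cap => // t'; rewrite e; apply: IH'.
split; first exact: Hcap.
have HcS t c j : size t = size s -> absorbs P t (Cross c j.+1).
  move=> e; apply: absorbs_crossS => //; last exact: Hcap.
  by move=> t'; rewrite e => /IH' [].
move=> c [|j]; last exact: HcS.
by apply: absorbs_cross0 => // j; apply: Hcap.
Qed.

(** Reading a closed diagram from the top, each of its upper parts vanishes on normal
    forms; the empty word is the only normal form below the whole diagram. *)
Theorem skein_closed_all P D : skein_closed P -> closed D -> P D.
Proof.
move=> hP cl.
have K : forall v s, run_from s v = Some [::] -> completes P s v.
  elim=> [|p v IH] s.
    move=> [->]; split=> // w hw; rewrite cats0.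
    move E: {1}[::] hw => t hw; case: hw E => [_|t0 x k w' t1 _ h E].
      exact: sc_empty.
    by have [s1 [s2 [_ _]]] := arc_over_state h; rewrite -E.
  by move=> /run_from_consP [t h1 /IH h2]; apply: (absorbs_piece hP h1 h2).
exact: ((K D [::] (eqP cl)).2 [::] layered_nil).
Qed.

(** * The Kauffman bracket on Morse words *)

Local Open Scope ring_scope.

(** Labels of the points of a horizontal line. Lines are made infinite to the right,
    so that all operators act on one space; a diagram leaves the distant labels alone.
    *)
Definition spins : Type := nat -> bool.

Definition del (i : nat) (x : spins) : spins :=
  fun k => x (if (k < i)%N then k else k.+2).

Definition ins (i : nat) (a : bool) (x : spins) : spins :=
  fun k => if (k < i)%N then x k
           else if k == i then a else if k == i.+1 then ~~ a else x (k - 2)%N.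

(** The coefficients for minima and maxima are such that a minimum and a maximum that
    straighten out have product 1, while the two labellings of a circle add up to
    [loop]. *)
Definition cupop (K : fieldType) (B : K) i (f : spins -> K) : spins -> K :=
  fun x => if x i == x i.+1 then 0
           else (if x i then 1 else - (B ^+ 2)^-1) * f (del i x).

Definition capop (K : fieldType) (B : K) i (f : spins -> K) : spins -> K :=
  fun x => - B ^+ 2 * f (ins i true x) + 1 * f (ins i false x).

(** The generator of the Temperley-Lieb algebra. *)
Definition hook (K : fieldType) (B : K) i (f : spins -> K) : spins -> K :=
  cupop B i (capop B i f).

(** Kauffman's skein relation. *)
Definition crossop (K : fieldType) (B : K) (c : bool) i (f : spins -> K) :
    spins -> K :=
  fun x => (if c then B else B^-1) * f x + (if c then B^-1 else B) * hook B i f x.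

Definition act (K : fieldType) (B : K) (p : piece) (f : spins -> K) : spins -> K :=
  match p with
  | Cup i _ => cupop B i f
  | Cap i => capop B i f
  | Cross c i => crossop B c i f
  end.

Definition acts (K : fieldType) (B : K) (D : diagram) (f : spins -> K) :=
  foldl (fun g p => act B p g) f D.

Definition bracket (K : fieldType) (B : K) (D : diagram) : K :=
  acts B D (fun=> 1) (fun=> false).

(** The value of a circle. *)
Definition loop (K : fieldType) (B : K) : K := - B ^+ 2 - (B ^+ 2)^-1.

Ltac spin_eq i j := let k := fresh "k" in apply: funext => k; rewrite /del /ins;
  case: (ltnP k i) => ?; case: (ltnP k j) => ?; case: (ltnP k j.+2) => ?;
  cbv beta iota; try (exfalso; lia);
  repeat (case: ifP => ?); try (by []); try (exfalso; lia);
  try (by congr (_ _); lia).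

Lemma del_ins i a x : del i (ins i a x) = x.
Proof. by spin_eq i i.+1. Qed.

Lemma del_insl i x : del i.+1 (ins i (x i) x) = x.
Proof. by spin_eq i i.+1. Qed.

Lemma del_insr i x : del i (ins i.+1 (~~ x i) x) = x.
Proof. spin_eq i i.+1; rewrite negbK; congr (_ _); lia. Qed.

Lemma del_del i j x : (i <= j)%N -> del j (del i x) = del i (del j.+2 x).
Proof. by move=> h; spin_eq i j. Qed.

Lemma del_ins_lt i j a x : (i <= j)%N -> del j.+2 (ins i a x) = ins i a (del j x).
Proof. by move=> h; spin_eq i j. Qed.

Lemma del_ins_gt i j a x : (i <= j)%N -> del i (ins j.+2 a x) = ins j a (del i x).
Proof. by move=> h; spin_eq i j. Qed.

Lemma ins_ins i j a b x : (i <= j)%N ->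
  ins j.+2 b (ins i a x) = ins i a (ins j b x).
Proof. by move=> h; spin_eq i j. Qed.

Lemma ins_l i a x : ins i a x i = a.
Proof. by rewrite /ins ltnn eqxx. Qed.

Lemma ins_r i a x : ins i a x i.+1 = ~~ a.
Proof. by rewrite /ins ltnNge leqnSn /= -[i.+1 == i]/(_) eqn_leq ltnn eqxx. Qed.

Lemma ins_lt i a x k : (k < i)%N -> ins i a x k = x k.
Proof. by rewrite /ins => ->. Qed.

Lemma ins_ge i a x k : (i <= k)%N -> ins i a x k.+2 = x k.
Proof. by move=> h; rewrite /ins; repeat (case: ifP => ?); try lia; congr x; lia. Qed.

Lemma del_lt i x k : (k < i)%N -> del i x k = x k.
Proof. by rewrite /del => ->. Qed.

Lemma del_ge i x k : (i <= k)%N -> del i x k = x k.+2.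
Proof. by rewrite /del ltnNge => ->. Qed.

(** All operators are linear; the relations between them below are therefore proved as
    identities between the coefficients of the Temperley-Lieb words. *)
Lemma act_linear (K : fieldType) (B : K) p a b f g :
  act B p (fun x => a * f x + b * g x) = fun x => a * act B p f x + b * act B p g x.
Proof.
have Hcup i f' g' : cupop B i (fun x => a * f' x + b * g' x) =
    fun x => a * cupop B i f' x + b * cupop B i g' x.
  by apply: funext => x; rewrite /cupop; case: ifP => _; ring.
have Hcap i f' g' : capop B i (fun x => a * f' x + b * g' x) =
    fun x => a * capop B i f' x + b * capop B i g' x.
  by apply: funext => x; rewrite /capop; ring.
case: p => [i d|i|c i] /=; rewrite ?Hcup ?Hcap //.
by apply: funext => x; rewrite /crossop /hook Hcap Hcup; ring.
Qed.

Lemma acts_linear (K : fieldType) (B : K) D a b f g :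
  acts B D (fun x => a * f x + b * g x) = fun x => a * acts B D f x + b * acts B D g x.
Proof. by elim: D f g => //= p D IH f g; rewrite act_linear IH. Qed.

Lemma hook_linear (K : fieldType) (B : K) i a b f g :
  hook B i (fun x => a * f x + b * g x) = fun x => a * hook B i f x + b * hook B i g x.
Proof.
rewrite /hook; have := act_linear B (Cap i) a b f g => /= ->.
exact: (act_linear B (Cup i true)).
Qed.

Section TL.
Variables (K : fieldType) (B : K) (hB : B != 0).
Implicit Types (f : spins -> K).

Lemma cap_cup i f : capop B i (cupop B i f) = fun x => loop B * f x.
Proof.
apply: funext => x; rewrite /capop /cupop !ins_l !ins_r !del_ins /loop /=.
by field.
Qed.

Lemma zigzagl i f : capop B i (cupop B i.+1 f) = f.
Proof.
apply: funext => x; rewrite /capop /cupop !ins_r !ins_ge //.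
have := del_insl i x; by case: (x i) => /= ->; field.
Qed.

Lemma zigzagr i f : capop B i.+1 (cupop B i f) = f.
Proof.
apply: funext => x; rewrite /capop /cupop !ins_l !(ins_lt _ _ (ltnSn i)).
have := del_insr i x; by case: (x i) => /= ->; field.
Qed.

Lemma cup_cup i j f : (i <= j)%N -> cupop B i (cupop B j f) = cupop B j.+2 (cupop B i f).
Proof.
move=> h; apply: funext => x; rewrite /cupop (del_ge x h) (del_ge x (leqW h)).
rewrite del_del //.
have -> : del j.+2 x i = x i by rewrite del_lt //; lia.
have -> : del j.+2 x i.+1 = x i.+1 by rewrite del_lt //; lia.
by case: (x i == _); case: (x j.+2 == _); rewrite ?mulr0 // mulrCA.
Qed.

Lemma cap_cup_far i j f : (i <= j)%N ->
  capop B i (cupop B j.+2 f) = cupop B j (capop B i f).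
Proof.
move=> h; apply: funext => x.
rewrite /capop /cupop !(ins_ge _ _ h) !(ins_ge _ _ (leqW h)).
rewrite !del_ins_lt //; case: ifP => _; ring.
Qed.

Lemma cup_cap_far i j f : (i <= j)%N ->
  cupop B i (capop B j f) = capop B j.+2 (cupop B i f).
Proof.
move=> h; apply: funext => x.
have h1 : (i < j.+2)%N by lia.
have h2 : (i.+1 < j.+2)%N by lia.
rewrite /capop /cupop !(ins_lt _ _ h1) !(ins_lt _ _ h2).
rewrite !del_ins_gt //; case: ifP => _; ring.
Qed.

Lemma cap_cap i j f : (i <= j)%N ->
  capop B i (capop B j.+2 f) = capop B j (capop B i f).
Proof.
move=> h; apply: funext => x; rewrite /capop !ins_ins //; ring.
Qed.

Lemma crossE c i f : crossop B c i f =
  fun x => (if c then B else B^-1) * f x +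
           (if c then B^-1 else B) * hook B i f x.
Proof. by []. Qed.

Lemma cup_linear i a b f g : cupop B i (fun x => a * f x + b * g x) =
    fun x => a * cupop B i f x + b * cupop B i g x.
Proof. exact: (act_linear B (Cup i true)). Qed.

Lemma cap_linear i a b f g : capop B i (fun x => a * f x + b * g x) =
    fun x => a * capop B i f x + b * capop B i g x.
Proof. exact: (act_linear B (Cap i)). Qed.

Lemma act_far p q f : (pos p + nin p <= pos q)%N ->
  act B p (act B q f) = act B (set_pos q (pos q - nin p + nout p)) (act B p f).
Proof.
case: p => [i b|i|c i] h; rewrite /nin /nout ?subn0 ?addn2 ?addn0 ?subnK;
  try (by move: h => /=; lia).
- have h' : (i <= pos q)%N by move: h => /=; lia.
  case: q h' {h} => [j d|j|d j] h' /=.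
  + exact: cup_cup.
  + exact: cup_cap_far.
  + by rewrite !crossE /hook cup_linear cup_cup // cup_cap_far.
- have {h} [j hj h'] : exists2 j, pos q = j.+2 & (i <= j)%N.
    by move: h => /= h; exists (pos q - 2)%N; lia.
  rewrite hj !subSS subn0; case: q hj => [j' d|j'|d j'] /= ->.
  + exact: cap_cup_far.
  + exact: cap_cap.
  + by rewrite !crossE /hook cap_linear cap_cup_far // cap_cap.
- have {h} [j hj h'] : exists2 j, pos q = j.+2 & (i <= j)%N.
    by move: h => /= h; exists (pos q - 2)%N; lia.
  case: q hj => [j' d|j'|d j'] /= ->; rewrite !subSS subn0.
  + by rewrite !crossE /hook (cup_linear j.+2) -(cup_cup _ h') -(cap_cup_far _ h').
  + by rewrite !crossE /hook (cap_linear j.+2) -(cup_cap_far _ h') -(cap_cap _ h').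
  + rewrite !crossE /hook (cap_linear i) (cup_linear i) (cap_linear j.+2) (cup_linear j.+2).
    rewrite -(cup_cap_far _ h') -(cup_cup _ h') -(cap_cap _ h') -(cap_cup_far _ h').
    by apply: funext => x; ring.
Qed.

Lemma hook_hook i f : hook B i (hook B i f) = fun x => loop B * hook B i f x.
Proof.
rewrite /hook cap_cup; apply: funext => x.
by rewrite /cupop; case: ifP => _; ring.
Qed.

Lemma hook_cupS i f : hook B i.+1 (cupop B i f) = cupop B i.+1 f.
Proof. by rewrite /hook zigzagr. Qed.

Lemma hook_cup i f : hook B i (cupop B i.+1 f) = cupop B i f.
Proof. by rewrite /hook zigzagl. Qed.

Lemma cap_hookS i f : capop B i (hook B i.+1 f) = capop B i.+1 f.
Proof. by rewrite /hook zigzagl. Qed.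

Lemma cap_hook i f : capop B i.+1 (hook B i f) = capop B i f.
Proof. by rewrite /hook zigzagr. Qed.

Lemma hookSK i f : hook B i (hook B i.+1 (hook B i f)) = hook B i f.
Proof. by rewrite {1}/hook cap_hookS cap_hook. Qed.

Lemma hookKS i f : hook B i.+1 (hook B i (hook B i.+1 f)) = hook B i.+1 f.
Proof. by rewrite {1}/hook cap_hook cap_hookS. Qed.

Lemma cross_cup c i f : crossop B c i (cupop B i f) =
  fun x => - (if c then (B ^+ 3)^-1 else B ^+ 3) * cupop B i f x.
Proof.
rewrite crossE /hook cap_cup; apply: funext => x; rewrite /cupop.
by case: (x i == _); case: c; rewrite /loop; field.
Qed.

Lemma cap_cross c i f : capop B i (crossop B c i f) =
  fun x => - (if c then (B ^+ 3)^-1 else B ^+ 3) * capop B i f x.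
Proof.
rewrite crossE (cap_linear i) /hook cap_cup; apply: funext => x.
by case: c; rewrite /loop; field.
Qed.

Lemma cross_cross c i f : crossop B (~~ c) i (crossop B c i f) = f.
Proof.
rewrite !crossE (hook_linear B i) hook_hook; apply: funext => x.
by case: c; rewrite /loop /=; field.
Qed.

Lemma slide_cup_act c i f :
  crossop B c i.+1 (cupop B i f) = crossop B (~~ c) i (cupop B i.+1 f).
Proof.
rewrite !crossE hook_cupS hook_cup; apply: funext => x.
by case: c => /=; ring.
Qed.

Lemma slide_cap_act c i f :
  capop B i (crossop B c i.+1 f) = capop B i.+1 (crossop B (~~ c) i f).
Proof.
rewrite !crossE (cap_linear i) (cap_linear i.+1) cap_hookS cap_hook.
by apply: funext => x; case: c => /=; ring.
Qed.

(** Expanding the crossings, both sides agree by the Temperley-Lieb relations and the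
    value of [loop]; the side condition excludes the triangles for which the
    coefficients of the two generators differ. *)
Lemma reidemeister3_act a b c i f : (b == a) || (b == c) ->
  crossop B c i (crossop B b i.+1 (crossop B a i f)) =
  crossop B a i.+1 (crossop B b i (crossop B c i.+1 f)).
Proof.
move=> h; rewrite !crossE.
rewrite !(hook_linear B i, hook_linear B i.+1) !hook_hook hookSK hookKS.
apply: funext => x; case: a b c h => [] [] [] //= _; rewrite /loop; field; exact: hB.
Qed.

End TL.

(** Minus the cube of [B] to the power minus the sign of the crossing: it compensates
    the effect of the first Reidemeister move on the bracket. *)
Definition crossing_framing (K : fieldType) (B : K) (s : seq bool) (p : piece) : K :=
  if p is Cross c i then
    if (nth false s i == nth false s i.+1) == c then - (B ^+ 3)^-1 else - B ^+ 3
  else 1.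

Fixpoint framing (K : fieldType) (B : K) (s : seq bool) (D : diagram) : K :=
  if D is p :: D' then
    crossing_framing B s p * (if step s p is Some s' then framing B s' D' else 1)
  else 1.

Section Framing.
Variables (K : fieldType) (B : K) (hB : B != 0).
Implicit Types (f : spins -> K).

Lemma framing_cat s s' u v : run_from s u = Some s' ->
  framing B s (u ++ v) = framing B s u * framing B s' v.
Proof.
elim: u s => [|p u IH] s; first by move=> [->]; rewrite mul1r.
by move=> /run_from_consP [t h1 h2] /=; rewrite h1 (IH _ h2) mulrA.
Qed.

Lemma framing_shift l r w : framing B (l ++ r) (shift (size l) w) = framing B r w.
Proof.
elim: w r => //= p w IH r; rewrite step_shift.
have -> : crossing_framing B (l ++ r) (set_pos p (size l + pos p)) = crossing_framing B r p.
  case: p => //= c i; rewrite -addnS !nth_cat !ltnNge !leq_addr /=.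
  by rewrite !addKn.
by case: (step r p) => //= r'; rewrite IH.
Qed.

Lemma step_nth s p s' : step s p = Some s' ->
  (forall k, (k < pos p)%N -> nth false s' k = nth false s k) /\
  (forall k, nth false s' (pos p + nout p + k) = nth false s (pos p + nin p + k)).
Proof.
case/stepP=> l [a [a' [r [-> -> <- la]]]]; have [<- <-] := local_size la.
split=> k; first by move=> h; rewrite !nth_cat h.
by rewrite !catA !nth_cat !size_cat !ltnNge !leq_addr /= !addKn.
Qed.

(** Distant pieces do not change the strands at a crossing, hence not its sign. *)
Lemma framing_far s p q s' : (pos p + nin p <= pos q)%N ->
  run_from s [:: q; p] = Some s' ->
  framing B s [:: q; p] =
  framing B s [:: p; set_pos q (pos q - nin p + nout p)].
Proof.
move=> h h1; have h2 := (far_run_from _ _ h).1 h1.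
move: h1 h2 => /run_from_consP [t ht _] /run_from_consP [t' ht' _] /=.
rewrite ht ht' /=.
have -> : crossing_framing B t p = crossing_framing B s p.
  case: p h {ht'} => //= c i h; rewrite !(step_nth ht).1 //; lia.
have -> : crossing_framing B t' (set_pos q (pos q - nin p + nout p)) = crossing_framing B s q.
  case: q h {ht} => //= c i h; have [_ e] := step_nth ht'.
  have := e (i - (pos p + nin p))%N; have := e (i.+1 - (pos p + nin p))%N.
  rewrite !subnKC ?(leqW h) //.
  have -> : (pos p + nout p + (i - (pos p + nin p)) = i - nin p + nout p)%N by lia.
  have -> : (pos p + nout p + (i.+1 - (pos p + nin p)) = (i - nin p + nout p).+1)%N by lia.
  by move=> -> ->.
have E (o : option (seq bool)) : (if o is Some _ then 1 else 1) = 1 :> K by case: o.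
by rewrite !E !mulr1 mulrC.
Qed.

Lemma framing_move_at0 r a b r' i f : move_at0 a b -> run_from r a = Some r' ->
  (fun x => framing B r a * acts B (shift i a) f x) =
  (fun x => framing B r b * acts B (shift i b) f x).
Proof.
case=> [d|d|c d|c|c d|c|c|a' b' c h]; rewrite /= ?addn0 ?addn1.
- rewrite zigzagl //; case: r => [|y r] //= _; rewrite ?take0 ?drop0.
  by apply: funext => x; case: y; case: d => /=; ring.
- rewrite zigzagr //; case: r => [|y r] //= _; rewrite ?take0 ?drop0.
  by apply: funext => x; case: y; case: d => /=; ring.
- rewrite slide_cup_act //; case: r => [|y r] //= _; rewrite ?take0 ?drop0.
  by apply: funext => x; case: y; case: d; case: c => /=; ring.
- rewrite slide_cap_act //; case: r => [|y [|z [|t r]]] //= h.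
  rewrite ?take0 ?drop0; apply: funext => x.
  by case: y z t h => [] [] [] // _; case: c => /=; ring.
- rewrite cross_cup // ?take0 ?drop0 => _; apply: funext => x.
  by case: c; case: d => /=; field.
- rewrite cap_cross //; case: r => [|y [|z r]] //= h.
  rewrite ?take0 ?drop0; apply: funext => x.
  by case: y z h => [] [] // _; case: c => /=; field.
- rewrite cross_cross //; case: r => [|y [|z r]] //= _; apply: funext => x.
  by case: y; case: z; case: c => /=; field.
- rewrite reidemeister3_act //; case: r => [|y [|z [|t r]]] //= _; rewrite ?take0 ?drop0.
  apply: funext => x; congr (_ * _).
  ring.
Qed.

Lemma framing_move s a b s' f : move a b -> run_from s a = Some s' ->
  (fun x => framing B s a * acts B a f x) =
  (fun x => framing B s b * acts B b f x).
Proof.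
move=> m hs; case/moveE: (m) => [[p [q [h ea eb]]]|[i [a0 [b0 [h ea eb]]]]].
  rewrite ea in hs *; rewrite eb (framing_far h hs).
  by rewrite [acts B [:: q; p] f]/= (act_far hB _ h).
have hi : (i <= size s)%N.
  rewrite leqNgt; apply/negP => hi; move: hs; rewrite ea shift_oversize //.
  by case: h.
have F w : framing B s (shift i w) = framing B (drop i s) w.
  by have := framing_shift (take i s) (drop i s) w; rewrite cat_take_drop size_takel.
rewrite ea eb !F.
have := run_from_shift (take i s) (drop i s) a0.
rewrite cat_take_drop size_takel // -ea hs.
case E: (run_from (drop i s) a0) => [r|] // _.
by rewrite ea; apply: framing_move_at0 h E.
Qed.

Definition kauffman (D : diagram) : K :=
  framing B [::] D * bracket B D / loop B.

Lemma acts_cat u v f : acts B (u ++ v) f = acts B v (acts B u f).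
Proof. exact: foldl_cat. Qed.

Lemma acts_scale D a f : acts B D (fun x => a * f x) = fun x => a * acts B D f x.
Proof.
have := acts_linear B D a 0 f f.
have -> : (fun x => a * f x + 0 * f x) = (fun x => a * f x).
  by apply: funext => x; rewrite mul0r addr0.
by move=> ->; apply: funext => x; rewrite mul0r addr0.
Qed.

(** The contribution of the middle part [a] is isolated, in a form in which a local
    identity of operators can be inserted. *)
Lemma kauffman_split u a v s s' : run_from [::] u = Some s -> run_from s a = Some s' ->
  kauffman (u ++ a ++ v) =
  framing B [::] u * framing B s' v / loop B *
  acts B v (fun x => framing B s a * acts B a (acts B u (fun=> 1)) x) (fun=> false).
Proof.
move=> hu ha; rewrite /kauffman /bracket !acts_cat acts_scale.
by rewrite (framing_cat _ hu) (framing_cat _ ha); ring.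
Qed.

Lemma kauffman_isotopic D D' : isotopic D D' -> kauffman D = kauffman D'.
Proof.
elim=> // [u a b v m cl cl'|D1 D2 D3 _ -> _ ->] //.
have := eqP cl => /run_from_catP [s hu /run_from_catP [s' ha hv]].
have := (move_run_from _ _ m).1 ha => hb.
by rewrite (kauffman_split v hu ha) (kauffman_split v hu hb) (framing_move _ m ha).
Qed.

Lemma kauffman_unknot b : loop B != 0 -> kauffman [:: Cup 0 b; Cap 0] = 1.
Proof.
move=> hl; rewrite /kauffman /bracket /= cap_cup //.
by case: b => /=; field.
Qed.


Lemma acts_linear_relation v a b c C g1 g2 g0 (x : spins) :
  (fun y => a * g1 y + b * g2 y) = (fun y => c * g0 y) ->
  a * (C * acts B v g1 x) + b * (C * acts B v g2 x) = c * (C * acts B v g0 x).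
Proof.
move=> e; have := congr1 (fun g => acts B v g x) e.
by rewrite acts_linear acts_scale => E; rewrite [RHS]mulrCA -E; ring.
Qed.


Lemma kauffman_skein t q Lp Lm L0 : t = (B ^+ 4)^-1 -> q = (B ^+ 2)^-1 ->
  skein_triple Lp Lm L0 ->
  t^-1 * kauffman Lp - t * kauffman Lm = (q - q^-1) * kauffman L0.
Proof.
move=> -> -> tr; rewrite -mulNr.
case: tr => u v i hpar cl; have := eqP cl => /run_from_catP [s hu /run_from_catP [s' hs hv]].
all: move: hpar; rewrite (top_run hu) => /andP [_ e].
all: have hm : run_from s [:: Cross false i] = Some s' by [].
all: have [l [x [y [r [es es' hl hx hy]]]]] := step_crossP (hs : step s _ = _).
- have e' : run_from s [::] = Some s'.
    by move: e; rewrite hx hy => /eqP exy; rewrite es es' exy.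
  have -> : u ++ v = u ++ [::] ++ v by [].
  rewrite (kauffman_split v hu hs) (kauffman_split v hu hm) (kauffman_split v hu e').
  apply: acts_linear_relation; apply: funext => z.
  have hs1 : step s (Cross true i) = Some s' by [].
  have hm1 : step s (Cross false i) = Some s' by [].
  rewrite /framing hs1 hm1 /crossing_framing e /= !crossE.
  by field; rewrite hB oner_neq0.
- have e' : run_from s [:: Cap i; Cup i (nth false s i.+1)] = Some s'.
    exact: smoothing_run_from (hs : step s _ = _) e.
  rewrite (kauffman_split v hu hs) (kauffman_split v hu hm) (kauffman_split v hu e').
  apply: acts_linear_relation; apply: funext => z.
  have hs1 : step s (Cross true i) = Some s' by [].
  have hm1 : step s (Cross false i) = Some s' by [].
  have e0 := e'; move/run_from_consP: e0 => [s1 h1]; rewrite run_from1 => h2.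
  rewrite /framing hs1 hm1 h1 h2 /crossing_framing (negbTE e) /= !crossE -/(hook B i _).
  by field; rewrite hB oner_neq0.
Qed.

Definition is_cross (p : piece) : bool := if p is Cross _ _ then true else false.

(** If the [n]-th power of [- B ^+ 3] is [-1], so is that of its inverse: the signs of
    the crossings are lost, only the parity of their number is left. *)
Lemma framing_pow s D s' n : (- B ^+ 3) ^+ n = -1 -> run_from s D = Some s' ->
  framing B s D ^+ n = (-1) ^+ count is_cross D.
Proof.
move=> hn; elim: D s => [|p D IH] s; first by rewrite expr1n.
move=> /run_from_consP [t h1 h2] /=; rewrite h1 exprMn (IH _ h2) exprD; congr (_ * _).
case: p {h1} => [i b|i|c i] /=; rewrite ?expr1n // expr1; case: ifP => _ //.
by rewrite -invrN exprVn hn invrN1.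
Qed.

(** [hook] has the single eigenvalue [loop] on its image, where a crossing acts as
    minus the inverse cube of [B] by the first Reidemeister move. The coefficient of
    [hook] is thus, up to the factor [loop], a difference of two powers. *)
Lemma twist_act k i : exists2 c, loop B * c = (- (B ^+ 3)^-1) ^+ k - B ^+ k &
  forall f, acts B (twist k i) f = fun x => B ^+ k * f x + c * hook B i f x.
Proof.
elim: k => [|k [c hc IH]].
  by exists 0; [rewrite mulr0 subrr | move=> f; apply: funext => x /=; ring].
exists (B ^+ k * B^-1 + c * B + B^-1 * (loop B * c)).
  have -> : loop B * (B ^+ k * B^-1 + c * B + B^-1 * (loop B * c)) =
    B ^+ k * (loop B / B) + (loop B * c) * (B + loop B / B) by ring.
  rewrite hc !exprS /loop; set X := _ ^+ k; set Y := B ^+ k.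
  by field; rewrite hB.
move=> f; rewrite /= IH crossE (hook_linear B i) (hook_hook hB).
by apply: funext => x; rewrite exprS; field.
Qed.

Lemma bracket_unorient D : bracket B D = bracket B (unorient D).
Proof.
rewrite /bracket /acts /unorient; elim: D (fun=> 1) => //= p D IH f.
by rewrite IH; case: p.
Qed.
End Framing.

(** * Invariants satisfying the skein relation *)

Record skein_invariant (K : fieldType) (t z : K) (f : diagram -> K) : Prop :=
  SkeinInvariant {
    si_isotopy D D' : closed D -> isotopic D D' -> f D = f D';
    si_skein Lp Lm L0 : skein_triple Lp Lm L0 ->
      t^-1 * f Lp - t * f Lm = z * f L0 }.

Definition circle : diagram := [:: Cup 0 true; Cap 0].

Lemma closed_circle D : closed (circle ++ D) = closed D.
Proof. by []. Qed.

Lemma isotopic_circle D D' : isotopic D D' -> isotopic (circle ++ D) (circle ++ D').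
Proof.
elim=> [u a b v m c c'|{}D|D1 D2 _ h|D1 D2 D3 _ h _ h'].
- exact: (@iso_move (circle ++ u) a b v m c c').
- exact: iso_refl.
- exact: iso_sym.
- exact: iso_trans h h'.
Qed.

Lemma skein_triple_circle Lp Lm L0 : skein_triple Lp Lm L0 ->
  skein_triple (circle ++ Lp) (circle ++ Lm) (circle ++ L0).
Proof.
case=> u v i p c; first exact: (@skein_parallel (circle ++ u) v i p c).
exact: (@skein_antiparallel (circle ++ u) v i p c).
Qed.

(** A circle at the left end of the line is distant from every piece, hence commutes
    with it. *)
Lemma tiso_circle s x u :
  tangle_iso s (u ++ [:: Cup 0 x; Cap 0]) ([:: Cup 0 x; Cap 0] ++ u).
Proof.
elim: u s => [|p u IH] s; first exact: tiso_refl.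
apply: (@tiso_step _ [:: p] (u ++ [:: Cup 0 x; Cap 0])
  ([:: Cup 0 x; Cap 0] ++ u) [::]); [by rewrite cats0|by move=> r _; apply: IH|].
apply: (@tiso_step _ [::] [:: p; Cup 0 x]
  [:: Cup 0 x; set_pos p (pos p).+2] (Cap 0 :: u)); first by rewrite /= cats0.
  by move=> r _; apply: tiso_move; apply: move_far => //=; lia.
apply: (@tiso_step _ [:: Cup 0 x] [:: set_pos p (pos p).+2; Cap 0]
  [:: Cap 0; p] u) => //; last exact: tiso_refl.
move=> r _; apply: tiso_move; rewrite -[X in move _ [:: _; X]](set_pos_id p).
have -> : set_pos p (pos p) = set_pos (set_pos p (pos p).+2) (pos p) by case: p.
by apply: move_far; case: p => //= *; lia.
Qed.

Lemma tiso_circle_flip s x :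
  tangle_iso s [:: Cup 0 x; Cap 0] [:: Cup 0 (~~ x); Cap 0].
Proof.
apply: (@tiso_step _ [:: Cup 0 x] [:: Cap 0] [:: Cross true 0; Cap 0] [::]) => //.
  by move=> r _; apply: tiso_back => //; apply: reidemeister1_cap.
apply: (@tiso_step _ [::] [:: Cup 0 x; Cross true 0] [:: Cup 0 (~~ x)] [:: Cap 0]) => //.
  by move=> r _; apply: tiso_move; apply: reidemeister1_cup.
exact: tiso_refl.
Qed.

Section SkeinInvariant.
Variables (K : fieldType) (t z : K) (f : diagram -> K).
Hypothesis hf : skein_invariant t z f.

Lemma si_red u v s a b : tangle_iso s a b -> run_from [::] u = Some s ->
  closed (u ++ a ++ v) -> f (u ++ a ++ v) = f (u ++ b ++ v).
Proof.
move=> h hu cl; have := eqP cl => /run_from_catP [s1]; rewrite hu => -[<-].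
move=> /run_from_catP [s' ha _]; have [_ /(_ u v hu cl) [_ i]] := h s' ha.
exact: (si_isotopy hf).
Qed.

(** The two crossings that make a kink in the minimum give isotopic diagrams, and
    their smoothing splits off a circle. *)
Lemma si_circle b w : closed (Cup 0 b :: w) ->
  z * f ([:: Cup 0 (~~ b); Cap 0] ++ Cup 0 b :: w) =
  (t^-1 - t) * f (Cup 0 b :: w).
Proof.
move=> cl.
have E c : closed ([:: Cup 0 (~~ b); Cross c 0] ++ w) /\
  f ([:: Cup 0 (~~ b); Cross c 0] ++ w) = f (Cup 0 b :: w).
  have c1 : closed ([:: Cup 0 (~~ b); Cross c 0] ++ w) by case: b cl.
  split=> //; rewrite (@si_red [::] w [::] [:: Cup 0 (~~ b); Cross c 0] [:: Cup 0 b]) //.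
  by rewrite -[in X in tangle_iso _ _ X](negbK b); apply/tiso_move/reidemeister1_cup.
have ap : antiparallel (top [:: Cup 0 (~~ b)]) 0 by case: (b).
have := si_skein hf (skein_antiparallel ap (E true).1).
rewrite /= (E true).2 (E false).2 => H; rewrite mulrBl H.
by case: (b).
Qed.

(** A circle is put beside every diagram, so that also the empty diagram has a value
    that the skein relation determines, and [skein_closed_all] applies. Removing this
    circle again divides by [t^-1 - t], which accounts for the hypothesis on [t]. *)
Lemma skein_invariant0 D : z != 0 -> t ^+ 2 != 1 -> t != 0 ->
  f circle = 0 -> closed D -> D <> [::] -> f D = 0.
Proof.
move=> z0 t1 t0 f0 cl nD.
have tt : t^-1 - t != 0.
  apply: contra t1; rewrite subr_eq0 => /eqP e.
  by rewrite expr2 -{1}e mulVf.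
have flip u b : closed u -> f (circle ++ u) = f ([:: Cup 0 b; Cap 0] ++ u).
  move=> cu; case: b => //.
  exact: (@si_red [::] u [::] circle [:: Cup 0 false; Cap 0]
    (@tiso_circle_flip [::] true) erefl cu).
have hP : skein_closed (fun E => f (circle ++ E) = 0).
  split=> //.
  - move=> E E' cE iE <-; apply: esym; apply: (si_isotopy hf) => //.
    exact: isotopic_circle.
  - move=> Lp Lm L0 /skein_triple_circle /(si_skein hf) H e0.
    move: H; rewrite e0 mulr0 => /eqP; rewrite subr_eq0 => /eqP H.
    split=> e; move: H; rewrite e mulr0.
      by move=> /esym/eqP; rewrite mulf_eq0 (negbTE t0) => /eqP.
    by move=> /eqP; rewrite mulf_eq0 invr_eq0 (negbTE t0) => /eqP.
  - move=> u v x clu e.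
    have := eqP clu => /run_from_catP [s hu hv].
    set c := [:: Cup 0 x; Cap 0].
    have cl1 : closed (circle ++ (u ++ c) ++ v).
      rewrite closed_circle closedE -catA run_from_cat hu.
      by apply/eqP; rewrite -hv /c; case: (x); case: (s).
    have cl2 : closed (circle ++ u ++ v) by rewrite closed_circle.
    have cl3 : closed (c ++ u ++ v) by rewrite /c; case: (x) clu.
    have e1 : f (circle ++ u ++ c ++ v) = f (circle ++ c ++ u ++ v).
      rewrite (catA u); rewrite (@si_red circle v [::] _ _ (@tiso_circle [::] x u) erefl cl1).
      by rewrite -catA.
    rewrite e1 (flip _ (~~ x)) //; apply: (mulfI z0).
    rewrite (si_circle (b := x) (w := Cap 0 :: u ++ v)) // mulr0.
    by rewrite -[_ :: _ :: _]/(c ++ u ++ v) -(flip _ x) // e mulr0.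
have := skein_closed_all hP cl.
case: D cl nD => // p D cl _.
have [b e] : exists b, p = Cup 0 b.
  have := eqP cl => /run_from_consP [r hr _].
  by case: p hr {cl} => [[|i] b|i|c i] //; exists b.
rewrite e in cl *; rewrite (flip _ (~~ b)) // => h.
have := si_circle cl; rewrite h mulr0 => /esym/eqP.
by rewrite mulf_eq0 (negbTE tt) => /eqP.
Qed.
End SkeinInvariant.

(** The evaluation is defined on representatives; equal fractions have equal values as
    soon as the denominators, powers of [s], do not vanish. *)
Lemma lfrac_leval (R : realType) (s : R[i]) a b : s != 0 ->
  lfrac a = lfrac b -> leval s a = leval s b.
Proof.
move=> s0; case: a b => [p n] [q m]; rewrite /lfrac /leval /=.
have X0 : sqrt_t != 0 by rewrite /sqrt_t tofrac_eq0 polyX_eq0.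
move=> /eqP; rewrite eqr_div ?expf_neq0 // /sqrt_t -!tofracXn -!tofracM tofrac_eq.
move=> /eqP /(congr1 (fun p => (map_poly intr p).[s])).
rewrite !rmorphM !rmorphXn /= map_polyX !hornerE => E.
by apply/eqP; rewrite eqr_div ?expf_neq0 // E.
Qed.

(** Used in the field of fractions, where the skein relation is given, and at [s],
    where it is wanted; in between it is an identity of polynomials. *)
Lemma clear_denominators (K : fieldType) (x a b c p q r : K) :
  x != 0 -> a != 0 -> b != 0 -> c != 0 ->
  ((x ^+ 2)^-1 * (p / a) - x ^+ 2 * (q / b) = (x - x^-1) * (r / c)) <->
  (p * b * c - x ^+ 4 * q * a * c = (x ^+ 3 - x) * r * a * b).
Proof.
move=> x0 a0 b0 c0.
have d0 : x ^+ 2 * a * b * c != 0 by rewrite !mulf_neq0 ?expf_neq0.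
have -> : p * b * c - x ^+ 4 * q * a * c =
    x ^+ 2 * a * b * c * ((x ^+ 2)^-1 * (p / a) - x ^+ 2 * (q / b)).
  by field; rewrite x0 a0 b0.
have -> : (x ^+ 3 - x) * r * a * b =
    x ^+ 2 * a * b * c * ((x - x^-1) * (r / c)).
  by field; rewrite x0 c0.
by split=> [-> //|]; apply: mulfI.
Qed.

Lemma lfrac_skein (R : realType) (s : R[i]) a b c : s != 0 ->
  (sqrt_t ^+ 2)^-1 * lfrac a - sqrt_t ^+ 2 * lfrac b
    = (sqrt_t - sqrt_t^-1) * lfrac c ->
  (s ^+ 2)^-1 * leval s a - s ^+ 2 * leval s b = (s - s^-1) * leval s c.
Proof.
move=> s0; case: a b c => [p n] [q m] [r l]; rewrite /lfrac /leval /=.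
have X0 : sqrt_t != 0 by rewrite /sqrt_t tofrac_eq0 polyX_eq0.
have C := @clear_denominators _ sqrt_t (sqrt_t ^+ n) (sqrt_t ^+ m) (sqrt_t ^+ l)
  (tofrac p) (tofrac q) (tofrac r) X0 (expf_neq0 _ X0) (expf_neq0 _ X0) (expf_neq0 _ X0).
move=> /(C.1) {C} E.
have {E} : tofrac (p * 'X^m * 'X^l - 'X^4 * q * 'X^n * 'X^l) =
           tofrac (('X^3 - 'X) * r * 'X^n * 'X^m).
  by rewrite !(tofracB, tofracM, tofracXn).
move=> /eqP; rewrite tofrac_eq.
move=> /eqP /(congr1 (fun p => (map_poly intr p).[s])).
have eM (f g : {poly int}) :
    (map_poly intr (f * g)).[s] = (map_poly intr f).[s] * (map_poly intr g).[s].
  by rewrite rmorphM hornerM.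
have eB (f g : {poly int}) :
    (map_poly intr (f - g)).[s] = (map_poly intr f).[s] - (map_poly intr g).[s].
  by rewrite rmorphB hornerD hornerN.
have eXn k : (map_poly intr ('X^k : {poly int})).[s] = s ^+ k.
  by rewrite map_polyXn hornerXn.
have eX : (map_poly intr ('X : {poly int})).[s] = s by rewrite map_polyX hornerX.
rewrite !(eB, eM, eXn, eX) => E.
exact: (clear_denominators _ _ _ s0 (expf_neq0 _ s0) (expf_neq0 _ s0)
  (expf_neq0 _ s0)).2 E.
Qed.

Lemma skein_invariant_leval (R : realType) (V : diagram -> laurent) (s : R[i]) :
  is_jones V -> s != 0 ->
  skein_invariant (s ^+ 2) (s - s^-1) (fun D => leval s (V D)).
Proof.
case=> iso _ sk s0; split=> [D D' c i|Lp Lm L0 /sk]; last exact: lfrac_skein.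
exact: lfrac_leval (iso _ _ c i).
Qed.

Lemma swap_run_from s i : (i.+1 < size s)%N -> exists s',
  [/\ forall c, step s (Cross c i) = Some s', forall c, step s' (Cross c i) = Some s,
      size s' = size s, nth false s' i = nth false s i.+1
    & nth false s' i.+1 = nth false s i].
Proof.
move=> h; exists (take i s ++ [:: nth false s i.+1, nth false s i & drop i.+2 s]).
have es : s = take i s ++ [:: nth false s i, nth false s i.+1 & drop i.+2 s].
  by rewrite -!drop_nth ?cat_take_drop // ltnW.
have st : size (take i s) = i by rewrite size_takel // ltnW // ltnW.
split.
- move=> c; apply/stepP.
  by exists (take i s), [:: nth false s i; nth false s i.+1],
   [:: nth false s i.+1; nth false s i], (drop i.+2 s); split=> //; eexists _, _.
- move=> c; apply/stepP.
  by exists (take i s), [:: nth false s i.+1; nth false s i],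
   [:: nth false s i; nth false s i.+1], (drop i.+2 s); split=> //; eexists _, _.
- by rewrite [in RHS]es !size_cat.
- by rewrite nth_cat st ltnn subnn.
- by rewrite nth_cat st ltnNge leqnSn subSnn.
Qed.

Lemma twistS k i : twist k.+1 i = twist k i ++ [:: Cross true i].
Proof. by rewrite /twist -addn1 nseqD. Qed.

Lemma twist_run_from s s' i : step s (Cross true i) = Some s' ->
  step s' (Cross true i) = Some s ->
  forall k, run_from s (twist k i) = Some (if odd k then s' else s).
Proof.
move=> h h'; elim=> // k IH; rewrite twistS run_from_cat IH /= run_from1.
by case: (odd k).
Qed.

Section Recurrences.
Variables (K : fieldType) (t z : K) (f : diagram -> K).
Hypothesis hf : skein_invariant t z f.

(** The skein relation at the last crossing of the twist: the negative crossing
    cancels the crossing below it. *)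
Lemma parallel_twist u v i : closed (u ++ v) -> parallel (top u) i ->
  forall k, closed (u ++ twist k i ++ v) /\
  t^-1 * f (u ++ twist k.+2 i ++ v) - t * f (u ++ twist k i ++ v) =
  z * f (u ++ twist k.+1 i ++ v).
Proof.
move=> cl par; have := eqP cl => /run_from_catP [s hu hv].
move: (par); rewrite (top_run hu) => /andP [hi /eqP e].
have hx : step s (Cross true i) = Some s.
  have [s' [h1 _ _ _ _]] := swap_run_from hi.
  have [l [x [y [r [es es' _ hx hy]]]]] := step_crossP (h1 true).
  by rewrite h1 es es'; move: e; rewrite hx hy => ->.
have hk k : run_from s (twist k i) = Some s by rewrite (twist_run_from hx hx); case: ifP.
have clk k : closed (u ++ twist k i ++ v).
  by rewrite closedE run_from_cat hu /= run_from_cat hk /= hv.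
move=> k; split=> //.
have hu1 : run_from [::] (u ++ twist k.+1 i) = Some s
  by rewrite run_from_cat hu; apply: hk.
have par1 : parallel (top (u ++ twist k.+1 i)) i.
  by rewrite (top_run hu1) -(top_run hu).
have c1 : closed ((u ++ twist k.+1 i) ++ [:: Cross true i] ++ v).
  by rewrite -catA (catA (twist _ _)) -twistS.
have := si_skein hf (skein_parallel par1 c1).
have -> : (u ++ twist k.+1 i) ++ [:: Cross true i] ++ v = u ++ twist k.+2 i ++ v.
  by rewrite (twistS k.+1) -!catA.
have -> : f ((u ++ twist k.+1 i) ++ [:: Cross false i] ++ v) =
          f (u ++ twist k i ++ v).
  have hk0 : run_from [::] (u ++ twist k i) = Some s
  by rewrite run_from_cat hu; apply: hk.
  rewrite twistS -!catA (catA u) (catA [:: Cross true i]).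
  rewrite (si_red (b := [::]) hf _ hk0) -?catA //.
    by apply/tiso_move/(reidemeister2 true).
  have hx' : step s (Cross false i) = Some s by [].
  by rewrite closedE catA run_from_cat hk0 /= run_from_cons hx /= run_from_cons hx' /= hv.
by rewrite -catA.
Qed.

Lemma tiso_twist_cap s k i : tangle_iso s (twist k i ++ [:: Cap i]) [:: Cap i].
Proof.
elim: k s => [|k IH] s; first exact: tiso_refl.
apply: (@tiso_step _ [:: Cross true i] (twist k i ++ [:: Cap i]) [:: Cap i] [::]).
- by rewrite cats0.
- by move=> r _; apply: IH.
- by apply: tiso_move; apply: reidemeister1_cap.
Qed.

(** The smoothing of the last crossing turns the other ones into kinks, so that it
    does not depend on [k]. *)
Lemma antiparallel_twist u v i : closed (u ++ v) -> antiparallel (top u) i ->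
  exists c, forall k, closed (u ++ twist k.*2 i ++ v) /\
  t^-1 * f (u ++ twist k.*2 i ++ v) - t * f (u ++ twist k.*2.+2 i ++ v) = z * c.
Proof.
move=> cl par; have := eqP cl => /run_from_catP [s hu hv].
move: (par); rewrite (top_run hu) => /andP [hi e].
have [s1 [h1 h2 ss n1 n2]] := swap_run_from hi.
have hk := twist_run_from (h1 true) (h2 true).
have hk2 k : run_from s (twist k.*2 i) = Some s by rewrite hk odd_double.
have hk1 k : run_from s (twist k.*2.+1 i) = Some s1 by rewrite hk /= odd_double.
have e1 : nth false s1 i != nth false s1 i.+1 by rewrite n1 n2 eq_sym.
have clk k : closed (u ++ twist k.*2 i ++ v).
  by rewrite closedE run_from_cat hu /= run_from_cat hk2 /= hv.
pose sm := [:: Cap i; Cup i (nth false s1 i.+1)].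
exists (f (u ++ sm ++ v)) => k; split=> //.
have hu1 : run_from [::] (u ++ twist k.*2.+1 i) = Some s1
  by rewrite run_from_cat hu; apply: hk1.
have par1 : antiparallel (top (u ++ twist k.*2.+1 i)) i.
  by rewrite (top_run hu1) /antiparallel ss hi e1.
have c1 : closed ((u ++ twist k.*2.+1 i) ++ [:: Cross true i] ++ v).
  by rewrite -catA (catA (twist _ _)) -twistS -doubleS.
have := si_skein hf (skein_antiparallel par1 c1).
rewrite (top_run hu1) -/sm.
have -> : (u ++ twist k.*2.+1 i) ++ [:: Cross true i] ++ v = u ++ twist k.*2.+2 i ++ v.
  by rewrite (twistS k.*2.+1) -!catA.
have -> : f ((u ++ twist k.*2.+1 i) ++ [:: Cross false i] ++ v) =
          f (u ++ twist k.*2 i ++ v).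
  have hk0 : run_from [::] (u ++ twist k.*2 i) = Some s
    by rewrite run_from_cat hu; apply: hk2.
  rewrite twistS -!catA (catA u) (catA [:: Cross true i]).
  rewrite (si_red (b := [::]) hf _ hk0) -?catA //.
    by apply/tiso_move/(reidemeister2 true).
  by rewrite closedE catA run_from_cat hk0 /= run_from_cons h1 /= run_from_cons h2 /= hv.
have hsm : run_from s1 sm = Some s by apply: smoothing_run_from (h2 true) e1.
have c2 : closed ((u ++ twist k.*2.+1 i) ++ sm ++ v).
  rewrite closedE run_from_cat hu1; apply/eqP.
  by rewrite -[LHS]/(run_from s1 (sm ++ v)) run_from_cat hsm.
have -> // : f ((u ++ twist k.*2.+1 i) ++ sm ++ v) = f (u ++ sm ++ v).
move: c2; have -> : (u ++ twist k.*2.+1 i) ++ sm ++ v =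
  u ++ (twist k.*2.+1 i ++ [:: Cap i]) ++ Cup i (nth false s1 i.+1) :: v.
  by rewrite /sm -!catA.
exact: (si_red hf (@tiso_twist_cap s _ i) hu).
Qed.
End Recurrences.

(** * Recurrences for twists *)

(** The characteristic roots are [s ^+ 3] and [- s]. They are distinct as [s ^+ 2] is
    not [-1], and the hypothesis on [k] makes their [k]-th powers equal. *)
Lemma second_order_recurrence (K : fieldType) (s : K) (a : nat -> K) k :
  s != 0 -> s ^+ 2 != -1 ->
  (forall j, (s ^+ 2)^-1 * a j.+2 - s ^+ 2 * a j = (s - s^-1) * a j.+1) ->
  (s ^+ 2) ^+ k = (-1) ^+ k -> a k = (- s) ^+ k * a 0%N.
Proof.
move=> s0 s1 rec sk.
have step2 j : a j.+2 = (s ^+ 3 - s) * a j.+1 + s ^+ 4 * a j.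
  have -> : a j.+2 = s ^+ 2 * ((s ^+ 2)^-1 * a j.+2 - s ^+ 2 * a j) + s ^+ 4 * a j.
    by field.
  by rewrite rec; field.
have sol j : (s ^+ 3 + s) * a j =
    (a 1%N + s * a 0%N) * (s ^+ 3) ^+ j + (s ^+ 3 * a 0%N - a 1%N) * (- s) ^+ j.
  suff [] : (s ^+ 3 + s) * a j =
    (a 1%N + s * a 0%N) * (s ^+ 3) ^+ j + (s ^+ 3 * a 0%N - a 1%N) * (- s) ^+ j /\
    (s ^+ 3 + s) * a j.+1 =
    (a 1%N + s * a 0%N) * (s ^+ 3) ^+ j.+1 + (s ^+ 3 * a 0%N - a 1%N) * (- s) ^+ j.+1.
    by [].
  elim: j => [|j [IH0 IH1]]; first by split; ring.
  split=> //; rewrite step2 mulrDr mulrCA IH1 (mulrCA _ (s ^+ 4)) IH0 !exprS.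
  by ring.
have nz : s ^+ 3 + s != 0.
  have -> : s ^+ 3 + s = s * (s ^+ 2 + 1) by ring.
  by rewrite mulf_neq0 // addr_eq0.
apply: (mulfI nz); rewrite sol.
have -> : (s ^+ 3) ^+ k = (- s) ^+ k.
  by rewrite exprSr exprMn sk -exprMn mulN1r.
by ring.
Qed.

(** Away from the fixed point the step multiplies by [s ^- 4], whose [k]-th power is
    1. If [s ^+ 2] is 1 the step is the identity. *)
Lemma affine_recurrence (K : fieldType) (s : K) (a : nat -> K) c k :
  s != 0 -> s ^+ 2 != -1 ->
  (forall j, (s ^+ 2)^-1 * a j - s ^+ 2 * a j.+1 = (s - s^-1) * c) ->
  (s ^+ 2) ^+ (2 * k) = 1 -> a k = a 0%N.
Proof.
move=> s0 s1 rec sk; set t := s ^+ 2 in s1 rec sk *.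
have t0 : t != 0 by apply: expf_neq0.
case: (eqVneq t 1) => [t1|t1].
  have z0 : s - s^-1 = 0.
    apply: (mulfI s0); rewrite mulrBr mulfV // mulr0 -expr2 -/t t1; exact: subrr.
  elim: k {sk} => // k <-; have := rec k; rewrite t1 z0 mul0r invr1 !mul1r => /eqP.
  by rewrite subr_eq0 => /eqP.
have tt : t^-1 - t != 0.
  have -> : t^-1 - t = - t^-1 * ((t - 1) * (t + 1)) by field.
  by rewrite mulf_neq0 ?oppr_eq0 ?invr_eq0 // mulf_neq0 // ?subr_eq0 // addr_eq0.
pose e := (s - s^-1) * c / (t^-1 - t).
have he : (s - s^-1) * c = (t^-1 - t) * e by rewrite /e [RHS]mulrC divfK.
have sol j : (t ^+ 2) ^+ j * (a j - e) = a 0%N - e.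
  elim: j => [|j <-]; first by rewrite mul1r.
  rewrite exprSr -mulrA; congr (_ * _).
  have -> : t ^+ 2 * (a j.+1 - e) =
    a j - t ^+ 2 * e - t * (t^-1 * a j - t * a j.+1) by field.
  by rewrite rec he; field.
by have := sol k; rewrite -exprM sk mul1r => /addIr.
Qed.

Lemma loop_neq0 (K : fieldType) (B : K) : B != 0 -> B ^+ 4 != -1 -> loop B != 0.
Proof.
move=> B0; apply: contra => /eqP l.
have : B ^+ 2 * loop B = 0 by rewrite l mulr0.
rewrite /loop mulrBr mulrN -exprD mulfV ?expf_neq0 // => /eqP.
by rewrite subr_eq0 eqr_oppLR.
Qed.

(** Uniqueness of the Jones polynomial at a given [t]: the difference of two solutions
    vanishes on the unknot. *)
Lemma kauffman_unique (K : fieldType) (B t q : K) (f : diagram -> K) D :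
  B != 0 -> t = (B ^+ 4)^-1 -> q = (B ^+ 2)^-1 -> t ^+ 2 != 1 ->
  skein_invariant t (q - q^-1) f -> f circle = 1 ->
  closed D -> D <> [::] -> f D = kauffman B D.
Proof.
move=> B0 et eq t1 hf f1 cl nD.
have q0 : q != 0 by rewrite eq invr_eq0 expf_neq0.
have etq : t = q ^+ 2 by rewrite et eq exprVn -exprM.
have l0 : loop B != 0.
  apply: loop_neq0 => //; apply: contra t1 => /eqP b4.
  by rewrite et b4 invrN1 sqrrN expr1n.
have z0 : q - q^-1 != 0.
  apply: contra t1; rewrite subr_eq0 => /eqP e.
  by rewrite etq [q ^+ 2]expr2 {1}e mulVf // expr1n.
have t0 : t != 0 by rewrite etq expf_neq0.
have hg : skein_invariant t (q - q^-1) (fun D => f D - kauffman B D).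
  split=> [E E' cE i|Lp Lm L0 tr].
    by rewrite (si_isotopy hf cE i) (kauffman_isotopic B0 i).
  rewrite [RHS]mulrBr -(si_skein hf tr) -(kauffman_skein B0 et eq tr); ring.
have := skein_invariant0 hg z0 t1 t0 _ cl nD.
rewrite f1 /circle kauffman_unknot // subrr => /(_ erefl) /eqP.
by rewrite subr_eq0 => /eqP.
Qed.

(** At these values the two eigenvalues of the twist coincide, so that it acts as a
    scalar. *)
Lemma bracket_twist (K : fieldType) (B : K) u v i k : B != 0 -> loop B != 0 ->
  odd k -> B ^+ (4 * k) = -1 ->
  bracket B (u ++ twist k i ++ v) = B ^+ k * bracket B (u ++ v).
Proof.
move=> B0 l0 ok hk; have [c hc E] := twist_act B0 k i.
have {hc} c0 : c = 0.
  apply: (mulfI l0); rewrite hc mulr0.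
  have -> : (- (B ^+ 3)^-1) ^+ k = - ((B ^+ k) ^+ 3)^-1.
    by rewrite exprNn -signr_odd ok expr1 mulN1r exprVn exprAC.
  have -> : - ((B ^+ k) ^+ 3)^-1 - B ^+ k = - ((B ^+ k) ^+ 3)^-1 * (1 + (B ^+ k) ^+ 4).
    by field; rewrite expf_neq0.
  by rewrite -(exprM B k 4) mulnC hk subrr mulr0.
rewrite /bracket !acts_cat E c0.
have -> (f g : spins -> K) : (fun x => B ^+ k * f x + 0 * g x) = (fun x => B ^+ k * f x).
  by apply: funext => x; rewrite mul0r addr0.
by rewrite acts_scale.
Qed.

Lemma count_cross_unorient D : count is_cross (unorient D) = count is_cross D.
Proof. by rewrite /unorient count_map; apply: eq_count => -[]. Qed.

(** The bracket does not see orientations, and the framing factors of the two diagrams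
    are such that only the numbers of crossings matter for the power [4 * k]. These
    differ by the odd number [k], and the resulting sign cancels that of [B ^+ k]. *)
Lemma kauffman_odd_twist (K : fieldType) (B : K) u v i k D' :
  B != 0 -> loop B != 0 -> odd k -> B ^+ (4 * k) = -1 ->
  closed (u ++ v) -> closed D' ->
  unorient D' = unorient (u ++ twist k i ++ v) ->
  exists2 w, w ^+ (4 * k) = 1 & kauffman B D' = w * kauffman B (u ++ v).
Proof.
move=> B0 l0 ok hk cl cl' un.
have h3 : (- B ^+ 3) ^+ (4 * k) = -1.
  rewrite exprNn exprM -signr_odd /= expr0 expr1n mul1r exprAC hk.
  by rewrite -signr_odd.
have F := framing_pow h3 (eqP cl); have F' := framing_pow h3 (eqP cl').
have nz : framing B [::] (u ++ v) != 0.
  apply/eqP => e; move: F; rewrite e expr0n /= muln_eq0 /=.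
  by case: (k) ok => //= n _ /esym/eqP; rewrite signr_eq0.
exists (framing B [::] D' / framing B [::] (u ++ v) * B ^+ k).
  rewrite exprMn expr_div_n F F' -exprM (mulnC k) exprM hk.
  rewrite -(count_cross_unorient D') un count_cross_unorient !count_cat.
  rewrite count_nseq mul1n !exprD -(signr_odd _ k) ok expr1 .
  by field; rewrite !signr_eq0.
rewrite /kauffman (bracket_unorient B D') un -bracket_unorient bracket_twist //.
by field; rewrite nz l0.
Qed.

Lemma cisD (R : realType) (x y : R) : cis (x + y) = cis x * cis y.
Proof. by rewrite /cis cosD sinD; apply/eqP; rewrite eq_complex /= !eqxx addrC eqxx. Qed.

Lemma cisMn (R : realType) (x : R) n : cis x ^+ n = cis (x *+ n).
Proof.
elim: n => [|n IH]; first by rewrite mulr0n /cis cos0 sin0.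
by rewrite exprS IH mulrS cisD.
Qed.

Lemma cis_pi_int (R : realType) (m : int) : cis (pi * m%:~R : R) = (-1) ^ m.
Proof.
have e1 : cis (pi : R) = -1.
  by apply/eqP; rewrite /cis cospi sinpi eq_complex /= oppr0 !eqxx.
have en n : cis ((pi : R) * n%:R) = (-1) ^+ n by rewrite mulr_natr -cisMn e1.
case: m => n; first exact: en.
rewrite NegzE mulrNz mulrN -exprnN; apply: (@mulfI _ (cis (pi * n.+1%:R : R))).
  by rewrite en signr_eq0.
rewrite -cisD subrr en mulfV ?signr_eq0 //.
by rewrite /cis cos0 sin0.
Qed.

Theorem corollary0p4 (R : realType) (V : diagram -> laurent) (hV : is_jones V)
    (L : diagram) (hL : closed L) (k : nat) (hk : (1 <= k)%N) :
  [/\ forall (L' : diagram) (m : int) (s : R[i]),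
        t_move k L L' ->
        (s ^+ 2) ^+ k = (-1) ^+ k ->
        s = - 'i%C * cis (pi * m%:~R / k%:R) ->
        s ^+ 2 != -1 ->
        leval s (V L') = (-1) ^ m * 'i%C ^+ k * leval s (V L),
      forall (L' : diagram) (s : R[i]),
        tbar_even_move (2 * k) L L' ->
        (s ^+ 2) ^+ (2 * k) = 1 ->
        s ^+ 2 != -1 ->
        leval s (V L') = leval s (V L)
    & forall (L' : diagram) (s : R[i]),
        odd k ->
        tbar_odd_move k L L' ->
        (s ^+ 2) ^+ k = -1 ->
        s ^+ 2 != -1 ->
        exists2 w : R[i], w ^+ (4 * k) = 1 &
          leval s (V L') = w * leval s (V L)].
Proof.
have nz (s : R[i]) n : (0 < n)%N -> (s ^+ 2) ^+ n != 0 -> s != 0.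
  by move=> n0; apply: contra => /eqP ->; rewrite !expf_eq0 n0 eqxx.
have k0 : k != 0%N by rewrite -lt0n.
split.
- move=> L' m s [u [v [i [cl par iL iL']]]] sk es s1.
  have s0 : s != 0 by apply: nz hk _; rewrite sk signr_eq0.
  have hf := skein_invariant_leval hV s0.
  have P := parallel_twist hf cl par.
  rewrite (si_isotopy hf hL iL) -(si_isotopy hf (P k).1 iL').
  rewrite (second_order_recurrence (a := fun j => leval s (V (u ++ twist j i ++ v)))
     s0 s1 (fun j => (P j).2) sk).
  congr (_ * _); rewrite es mulNr opprK exprMn cisMn mulrC; congr (_ * _).
  have -> : pi * m%:~R / k%:R *+ k = pi * m%:~R :> R.
    by rewrite -[LHS]mulr_natr divfK // pnatr_eq0.
  exact: cis_pi_int.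
- move=> L' s [u [v [i [_ cl par iL iL']]]] sk s1.
  have s0 : s != 0 by apply: (nz _ (2 * k)%N); rewrite ?muln_gt0 // sk oner_neq0.
  have hf := skein_invariant_leval hV s0.
  have [c P] := antiparallel_twist hf cl par.
  move: iL'; rewrite mul2n => iL'.
  rewrite (si_isotopy hf hL iL) -(si_isotopy hf (P k).1 iL').
  exact: (affine_recurrence (a := fun j => leval s (V (u ++ twist j.*2 i ++ v)))
     s0 s1 (fun j => (P j).2) sk).
- move=> L' s ok [u [v [i [D' [_ cl par [cl' un _] [iL iL']]]]]] sk s1.
  have s0 : s != 0 by apply: nz hk _; rewrite sk oppr_eq0 oner_neq0.
  have hf := skein_invariant_leval hV s0.
  rewrite (si_isotopy hf hL iL) -(si_isotopy hf cl' iL').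
  pose B : R[i] := sqrtC s^-1.
  have B2 : B ^+ 2 = s^-1 by apply: sqrtCK.
  have B0 : B != 0 by apply: contra s0 => /eqP e; rewrite -invr_eq0 -B2 e expr0n.
  have eq : s = (B ^+ 2)^-1 by rewrite B2 invrK.
  have et : s ^+ 2 = (B ^+ 4)^-1 by rewrite eq exprVn -exprM.
  have t1 : (s ^+ 2) ^+ 2 != 1.
    rewrite -subr_eq0 subr_sqr_1 mulf_neq0 //; last by rewrite addr_eq0.
    rewrite subr_eq0.
    apply/eqP => e; move/eqP: sk; rewrite e expr1n -addr_eq0.
    by rewrite -[1 + 1]/(2%:R) pnatr_eq0.
  have f1 : leval s (V circle) = 1.
    case: hV => _ /(_ true) h _.
    rewrite (@lfrac_leval _ _ _ (1, 0%N) s0).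
      by rewrite /leval rmorph1 hornerC expr0 divr1.
    by rewrite h /lfrac /= tofrac1 expr0 divr1.
  have uniq D : closed D -> D <> [::] -> leval s (V D) = kauffman B D.
    exact: (kauffman_unique B0 et eq t1 hf f1).
  have hB : B ^+ (4 * k) = -1.
    by rewrite exprM -[B ^+ 4]invrK -et exprVn sk invrN1.
  have l0 : loop B != 0.
    by apply: loop_neq0 => //; apply: contra s1 => /eqP b4; rewrite et b4 invrN1.
  have nu : u ++ v <> [::].
    by case: u par {un cl iL} => // /andP [].
  have nD : D' <> [::].
    move=> e; move/(congr1 size): un; rewrite e /unorient !size_map !size_cat /= size_nseq.
    by case: (k) k0 => // n _; rewrite addnC.
  rewrite !uniq //; exact: kauffman_odd_twist un.
Qed.
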